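(* Let $(k,m,s)\in X=\{(k,m,s)\in\mathbb{Z}^3: 1\le k,\ 1\le m,\ 0\le s<m\}$. Then there is a graph in $\mathcal{P}$ whose orbit is the one-point set $\{(k,m,s)\}$ if and only if $m=kn$ and $s=kx$ for some integers $0\le x<n$ such that $n$ is a divisor of $x^2+x+1$.
   Context: Graphs are finite and loopless but may have multiple edges. A plane triangulation is a plane graph all of whose faces (including the outer one) are bounded by cycles of length 3. $\mathcal{P}$ is the family of all 2-connected plane triangulations all of whose vertices have degree 3 or 6. $Q=\{0,1,2\}$ is the cyclic group of integers modulo 3. For $P\in\mathcal{P}$ fix a partition of the edge set into three classes indexed by $Q$ such that for every vertex $v$, if two edges are counterclockwise successive edges incident with $v$, then the first is of class $q$ and the second is of class $q+1$ for some $q\in Q$ (such a partition is known to exist, by Grünbaum and Motzkin). A subgraph is of class $q$ if all of its edges are of class $q$. It is known that the spanning subgraph $P_q$ formed by the edges of class $q$ consists of two induced paths (the maximal paths of class $q$, whose ends are the four vertices of degree 3) of the same length, denoted $M(q)$, and of $K(q)-1$ induced cycles of the same length $2M(q)$, where $K(q)$ is the distance in $P$ between the two maximal paths of class $q$. For a vertex $A$ of degree 3, $[A,q]$ denotes the maximal path of class $q$ having $A$ as an end, oriented as $v_0v_1\ldots v_{M(q)}$ with initial vertex $A=v_0$ and terminal vertex $A_q=v_{M(q)}$. An edge is adjacent to a path if it does not belong to the path but is incident with a vertex of it. An edge $e$ adjacent to $[A,q]$ at the vertex $v_j$ is a left branch of $[A,q]$ if either $0\le j<M(q)$ and $v_jv_{j+1},e$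 are counterclockwise successive edges at $v_j$, or $0<j\le M(q)$ and $e,v_{j-1}v_j$ are counterclockwise successive edges at $v_j$; otherwise it is a right branch. Put $[A,q](e)=j$ if $e$ is a left branch and $[A,q](e)=2M(q)-j$ if $e$ is a right branch. Let $A,C$ be ends of the two different maximal paths of class $q$. Let $f$ be the first edge of the oriented path $[C,q+1]$ which is adjacent to $[A,q]$. Then $S^+(q)=[A,q](f)$ if $f$ is a left branch of $[A,q]$ and $S^+(q)=[A,q](f)-M(q)$ if $f$ is a right branch. This value does not depend on the choice of $A$ and $C$, and $0\le S^+(q)<M(q)$. The vector $(K(q),M(q),S^+(q))$ is the $q$-index-vector of $P$, and the orbit of $P$ is the set $\{(K(q),M(q),S^+(q)):q\in Q\}$. The set $X$ is the set of all index-vectors of graphs in $\mathcal{P}$ (every element of $X$ is an index-vector of some graph in $\mathcal{P}$). *)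

(* Defs.v *)
From HB Require Import structures.
From mathcomp Require Import all_boot all_order all_algebra all_fingroup.

Set Implicit Arguments.
Unset Strict Implicit.
Unset Printing Implicit Defensive.

Import GRing.Theory Num.Theory.
Local Open Scope ring_scope.

(* A multigraph without isolated vertices, drawn on an oriented closed surface,
   as a combinatorial map.  A dart is an edge with a direction; it is incident
   with its initial vertex.  [dopp] reverses a dart, and [ccw] sends a dart to
   the counterclockwise next dart with the same initial vertex. *)
Record graph_map := GraphMap {
  dart : finType;
  dopp : {perm dart};
  ccw : {perm dart};
  doppK : involutive dopp;
  dopp_neq : forall d, dopp d != d }.

Section GraphMap.

Variable G : graph_map.
Implicit Types (d e f : dart G) (p r t w : seq (dart G)) (A B C : {set dart G}).

(* Vertices and edges are sets of darts, so that #|A| is the degree of A. *)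
Definition vtx d : {set dart G} := porbit (ccw G) d.
Definition edge d : {set dart G} := porbit (dopp G) d.
Definition vertices : {set {set dart G}} := porbits (ccw G).
Definition edges : {set {set dart G}} := porbits (dopp G).

(* The boundary walk keeping the face on its left: from the end of d, continue
   along the clockwise next dart after dopp d. *)
Definition face_perm : {perm dart G} := (dopp G * (ccw G)^-1)%g.
Definition faces : {set {set dart G}} := porbits face_perm.

Definition adjv : rel {set dart G} :=
  fun A B => [exists d, (vtx d == A) && (vtx (dopp G d) == B)].

Definition connected_on (U : {set {set dart G}}) : Prop :=
  forall A B, A \in U -> B \in U ->
    connect (fun u v => [&& u \in U, v \in U & adjv u v]) A B.

Definition connected : Prop := connected_on vertices.

Definition two_connected : Prop :=
  [/\ (2 < #|vertices|)%N, connected &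
      forall A, A \in vertices -> connected_on (vertices :\ A)].

Definition loopless : Prop := forall d, vtx (dopp G d) != vtx d.

(* Euler's formula: a connected map is a plane map iff it has genus 0. *)
Definition plane : Prop :=
  connected /\ (#|vertices| + #|faces|)%N = (#|edges| + 2)%N.

Definition face_triangle d : bool :=
  (#|porbit face_perm d| == 3)%N
  && uniq [:: vtx d; vtx (face_perm d); vtx (face_perm (face_perm d))].

Definition plane_triangulation : Prop :=
  [/\ loopless, plane & forall d, face_triangle d].

Definition family_P : Prop :=
  [/\ plane_triangulation, two_connected &
      forall A, A \in vertices -> (#|A| == 3)%N || (#|A| == 6)%N].

Definition class_partition (c : dart G -> 'Z_3) : Prop :=
  forall d, c (dopp G d) = c d /\ c (ccw G d) = c d + 1.

(* A nontrivial path v_0 v_1 ... v_m is given by the sequence of its m darts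
   v_j v_(j+1), which also orients it. *)
Definition path_vertices p : seq {set dart G} :=
  if p is d :: _ then vtx d :: [seq vtx (dopp G e) | e <- p] else [::].

Definition path_edges p : {set {set dart G}} := [set edge d | d in p].

Definition is_path p : bool :=
  [&& p != [::], sorted (fun d e => vtx (dopp G d) == vtx e) p
    & uniq (path_vertices p)].

Section Classes.

Variable c : dart G -> 'Z_3.
Implicit Type q : 'Z_3.

Definition class_path q p : bool := is_path p && all (fun d => c d == q) p.

Definition maximal_class_path q p : Prop :=
  class_path q p /\ forall w, class_path q w -> infix p w -> w = p.

(* p is the oriented path [A, q]. *)
Definition path_from A q p : Prop :=
  [/\ A \in vertices, #|A| = 3%N, maximal_class_path q p
    & nth set0 (path_vertices p) 0%N = A].

Definition is_dist (U W : seq {set dart G}) (k : nat) : Prop :=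
  (exists A s, [/\ A \in U, path adjv A s, last A s \in W & size s = k]) /\
  (forall A s, A \in U -> path adjv A s -> last A s \in W -> (k <= size s)%N).

Definition adjacent p d : bool :=
  (edge d \notin path_edges p)
  && [exists e in edge d, vtx e \in path_vertices p].

Definition adjacent_at p (j : nat) d : bool :=
  [&& edge d \notin path_edges p, (j <= size p)%N
    & vtx d == nth set0 (path_vertices p) j].

(* The default value d of nth is never used. *)
Definition left_branch p (j : nat) d : bool :=
  ((j < size p)%N && (ccw G (nth d p j) == d))
  || ((0 < j <= size p)%N && (ccw G d == dopp G (nth d p j.-1))).

(* [A, q](e), for e the edge of a dart d adjacent to p = [A, q] at v_j *)
Definition branch_index p (j : nat) d : int :=
  if left_branch p j d then j%:Z else 2 * (size p)%:Z - j%:Z.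

Definition branch_shift p (j : nat) d : int :=
  if left_branch p j d then branch_index p j d
  else branch_index p j d - (size p)%:Z.

Definition first_adjacent p t f : Prop :=
  exists t1 t2, [/\ t = t1 ++ f :: t2, adjacent p f & ~~ has (adjacent p) t1].

(* s is S^+(q), computed from p = [A, q] and t = [C, q+1]. *)
Definition is_Splus p t (s : int) : Prop :=
  exists f e j, [/\ first_adjacent p t f, e \in edge f, adjacent_at p j e
                  & s = branch_shift p j e].

Definition index_vector q (v : int * int * int) : Prop :=
  exists A C p r t (k : nat) (s : int),
    [/\ path_from A q p /\ path_from C q r,
        path_edges p != path_edges r,
        is_dist (path_vertices p) (path_vertices r) k,
        path_from C (q + 1) t /\ is_Splus p t s
      & v = (k%:Z, (size p)%:Z, s)].

Definition index_orbit (v : int * int * int) : Prop :=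
  exists q, index_vector q v.

End Classes.

End GraphMap.

(* Main.v *)
(* Let w be a primitive sixth root of unity.  Walking straight ahead from a dart,
   or from a dart turned left by 60 degrees, gives two commuting permutations of
   the darts, i.e. an action of the lattice Z[w].  For a dart d at a vertex of
   degree 3, the vectors leading from d to a vertex of degree 3 form a sublattice
   L of Z[w] and the stabilizer of d is 2L; thus P is the quotient of the
   triangular lattice by the half-turns about the points of L.  The index-vector
   (k, m, s) of the class of d is the Hermite normal form of L: L is generated by
   m and s + k w.  Passing to the next class replaces L by w^-1 L, so the orbit is
   a single point iff w L = L, that is, iff L is an ideal of Z[w].  The ideals are
   the lattices k (Z n + Z (x + w)) where n divides x^2 + x + 1.  Conversely, for
   such an ideal L the quotient is built from darts in (Z[w] / 2L) x Z/3. *)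
Require Import Defs.
From mathcomp Require Import all_boot all_order all_algebra all_fingroup.
From mathcomp Require Import zify.

Set Implicit Arguments.
Unset Strict Implicit.
Unset Printing Implicit Defensive.

Import GRing.Theory Num.Theory.
Local Open Scope ring_scope.

(** * The action of Z[w] on darts *)

Section IntegerPowers.

Variable gT : finGroupType.
Implicit Types (x y : gT) (a b : int).

Definition expgz x a : gT :=
  match a with Posz n => (x ^+ n)%g | Negz n => (x ^- n.+1)%g end.

Lemma expgzS x a : expgz x (a + 1) = (expgz x a * x)%g.
Proof.
case: a => [n|[|n]].
- by rewrite -PoszD addn1 /= expgSr.
- by rewrite /= expg1 mulVg.
have -> : Negz n.+1 + 1 = Negz n by lia.
by rewrite /= [in RHS]expgS invMg mulgKV.
Qed.

Lemma expgzD x a b : expgz x (a + b) = (expgz x a * expgz x b)%g.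
Proof.
elim: b => [|n IH|n IH]; first by rewrite addr0 /= expg0 mulg1.
- by rewrite -addn1 PoszD addrA !expgzS IH mulgA.
- apply: (mulIg x); rewrite -mulgA -!expgzS.
  have -> : - n.+1%:Z + 1 = - n%:Z by lia.
  have -> : a - n.+1%:Z + 1 = a - n%:Z by lia.
  exact: IH.
Qed.

Lemma expgzN x a : expgz x (- a) = (expgz x a)^-1%g.
Proof.
apply: (mulgI (expgz x a)); rewrite -expgzD subrr mulgV; exact: expg0.
Qed.

Lemma expgzJ x y a : expgz (x ^ y)%g a = (expgz x a ^ y)%g.
Proof. by case: a => n; rewrite /= ?conjVg conjXg. Qed.

Lemma expgzV x a : expgz x^-1%g a = (expgz x a)^-1%g.
Proof. by case: a => n; rewrite /= expVgn ?invgK. Qed.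

Lemma commute_expgz x y a : commute x y -> commute x (expgz y a).
Proof. by case: a => n xy /=; [|apply: commuteV]; apply: commuteX. Qed.

Lemma expgzMn x y a : commute x y -> expgz (x * y)%g a = (expgz x a * expgz y a)%g.
Proof.
case: a => n xy /=; rewrite expgMn //.
by rewrite invMg; apply: commuteV; apply: commute_sym; apply: commuteV;
   apply: commuteX; apply: commute_sym; apply: commuteX.
Qed.

End IntegerPowers.

(** * The commuting translations by 1 and w, and their behaviour under rotation *)

Section Translations.

Variable G : graph_map.
Implicit Type d : dart G.

Local Notation rho := (ccw G).
Local Notation tau := (dopp G).

(** Products of permutations act from left to right. At the far end of the edge, [rho ^+ 3] turns
    the reversed dart into the one pointing ahead; at a vertex of degree 3 it is trivial, so the
    walk goes back. In [veer] the initial left turn by 60 degrees is undone at the end, hence the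
    exponent 2 = 3 - 1. *)
Definition straight : {perm dart G} := (tau * rho ^+ 3)%g.
Definition veer : {perm dart G} := (rho * tau * rho ^+ 2)%g.

(* If [d] points in the direction of the unit vector 1, [translate d a b] is the
   dart parallel to [d] at the vector [a + b w] from it. *)
Definition translate d (a b : int) : dart G :=
  (expgz straight a * expgz veer b)%g d.

(** These two relations hold for the graphs of [family_P] and for the map built from an ideal, so
    the theory below serves both directions of the equivalence. *)
Hypothesis ccw6 : (rho ^+ 6 = 1)%g.
Hypothesis face3 : (face_perm G ^+ 3 = 1)%g.

Lemma dopp2 : (tau * tau = 1)%g.
Proof. by apply/permP=> d; rewrite permM perm1 doppK. Qed.

(** The triangle relation, solved for a word with a clockwise turn between two reversals. *)
Lemma dopp_ccwV_dopp : (tau * rho^-1 * tau = rho * tau * rho)%g.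
Proof.
apply: (mulIg (rho^-1 * tau * rho^-1)%g); rewrite !mulgA mulgK.
rewrite -[(_ * tau * tau)%g]mulgA dopp2 mulg1 mulgV.
by move: face3; rewrite /face_perm !expgS expg0 mulg1 !mulgA.
Qed.

(** Both products reduce to [tau * rho ^+ 4 * tau * rho ^+ 2]: since [rho ^+ 4] is [rho ^- 2], the
    first three factors are the square of [tau * rho^-1 * tau], to which the triangle relation
    applies. *)
Lemma straight_veer : commute straight veer.
Proof.
have tt x : (x * tau * tau = x)%g by rewrite -mulgA dopp2 mulg1.
have E4 : (tau * rho ^+ 4 * tau = rho * tau * rho ^+ 2 * tau * rho)%g.
  have -> : (rho ^+ 4 = rho^-1 * rho^-1)%g.
    by apply: (mulIg (rho * rho)%g); rewrite !mulgA mulgKV mulVg -!expgSr ccw6.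
  transitivity ((tau * rho^-1 * tau) * (tau * rho^-1 * tau))%g.
    by rewrite !mulgA tt.
  by rewrite !dopp_ccwV_dopp !mulgA.
rewrite /commute /straight /veer.
transitivity ((tau * rho ^+ 4 * tau) * rho ^+ 2)%g; first by rewrite !expgS expg0 !mulg1 !mulgA.
by rewrite E4 !expgS expg0 !mulg1 !mulgA.
Qed.

(** Together with [veerE], the change of frame from [d] to [rho d]: there 1 becomes w, and w becomes
    w^2 = w - 1. *)
Lemma straightE : (straight = veer ^ rho)%g.
Proof. by rewrite conjgE /veer /straight !expgS expg0 !mulg1 !mulgA mulVg mul1g. Qed.

Lemma veerE : (veer = (veer * straight^-1) ^ rho)%g.
Proof.
have tauV : (tau^-1 = tau)%g by apply/eqP; rewrite eq_invg_mul dopp2.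
apply: (mulgI rho); rewrite conjgE !mulgA mulgV mul1g.
transitivity (rho * (tau * rho^-1 * tau) * rho)%g.
  by rewrite dopp_ccwV_dopp !mulgA.
by rewrite /straight !expgS expg0 mulg1 !invMg tauV !mulgA !mulgK.
Qed.

Lemma translate0 d : translate d 0 0 = d.
Proof. by rewrite /translate /= !expg0 mulg1 perm1. Qed.

Lemma translateD d a b a' b' :
  translate (translate d a b) a' b' = translate d (a + a') (b + b').
Proof.
rewrite /translate -permM !expgzD; congr (_ _ d).
have C : commute (expgz veer b) (expgz straight a').
  apply: commute_expgz; apply: commute_sym; apply: commute_expgz.
  exact: straight_veer.
by rewrite -!mulgA; congr (_ * _)%g; rewrite !mulgA C.
Qed.

Lemma translate10 d : translate d 1 0 = straight d.
Proof. by rewrite /translate /= expg0 expg1 mulg1. Qed.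

Lemma translate_nat d n : translate d n%:Z 0 = iter n straight d.
Proof. by rewrite /translate /= expg0 mulg1 permX. Qed.

(** Multiplication by w: w (a + b w) = - b + (a + b) w, since w^2 = w - 1. *)
Lemma translate_ccw d a b : translate (rho d) a b = rho (translate d (- b) (a + b)).
Proof.
have push x n : (rho * expgz (x ^ rho) n = expgz x n * rho)%g.
  by rewrite expgzJ -conjgC.
rewrite /translate -!permM; congr (fun_of_perm _ d).
rewrite {1}straightE mulgA push -mulgA {2}veerE push mulgA (@expgzMn _ veer).
  rewrite expgzV -expgzN mulgA -expgzD; congr (_ * _)%g.
  apply/commute_expgz/commute_sym/commute_expgz; exact: straight_veer.
by apply: commuteV; apply: commute_sym; apply: straight_veer.
Qed.

(** The rotation by 180 degrees about the initial vertex; the vertices of degree 3 turn out to be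
    those whose darts it fixes ([card_vtx3]). *)
Definition half_turn d := rho (rho (rho d)).

Lemma half_turn_translate d a b :
  half_turn (translate d a b) = translate (half_turn d) (- a) (- b).
Proof.
by rewrite /half_turn !translate_ccw; congr (rho (rho (rho (translate d _ _)))); lia.
Qed.

Lemma half_turnK d : half_turn (half_turn d) = d.
Proof.
have -> : half_turn (half_turn d) = (rho ^+ 6)%g d by rewrite permX.
by rewrite ccw6 perm1.
Qed.

Lemma ccw_half_turn d : rho (half_turn d) = half_turn (rho d). Proof. by []. Qed.

(** Reversing a dart is stepping forward and turning round. With this, incidence becomes arithmetic
    of translations and half-turns. *)
Lemma dopp_half_turn d : tau d = half_turn (translate d 1 0).
Proof. by rewrite translate10 /straight permM permX -[LHS]half_turnK. Qed.

End Translations.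

Lemma Z3_add1_neq (q : 'Z_3) : (q + 1 == q) = false.
Proof. by case: q => [[|[|[|?]]] ?]. Qed.

Lemma Z3_add2_neq (q : 'Z_3) : (q + 1 + 1 == q) = false.
Proof. by case: q => [[|[|[|?]]] ?]. Qed.

Lemma Z3_add3 (q : 'Z_3) : q + 1 + 1 + 1 = q.
Proof. by apply/val_inj; case: q => [[|[|[|?]]] ?]. Qed.

(** * Darts at a vertex: classes and degrees *)

Section Vertices.

Variables (G : graph_map) (c : dart G -> 'Z_3).
Hypothesis ccw6 : (ccw G ^+ 6 = 1)%g.
Hypothesis cP : class_partition c.
Implicit Types d e : dart G.

Local Notation rho := (ccw G).
Local Notation tau := (dopp G).

Lemma class_dopp d : c (tau d) = c d. Proof. by case: (cP d). Qed.
Lemma class_ccw d : c (rho d) = c d + 1. Proof. by case: (cP d). Qed.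

Lemma class_half_turn d : c (half_turn d) = c d.
Proof. by rewrite /half_turn !class_ccw Z3_add3. Qed.

Lemma class_translate d a b : c (translate d a b) = c d.
Proof.
have inv (f : {perm dart G}) : (forall e, c (f e) = c e) ->
    forall n e, c (expgz f n e) = c e.
  move=> cf.
  have it n e : c (iter n f e) = c e by elim: n => //= n <-.
  case=> n e /=; rewrite ?permX //.
  by rewrite -(it n.+1 ((f ^+ n.+1)^-1%g e)) -permX permKV.
rewrite /translate permM !inv // => e.
  by rewrite /straight permM permX /= !class_ccw class_dopp Z3_add3.
by rewrite /veer permM permX permM /= !class_ccw class_dopp class_ccw Z3_add3.
Qed.

Lemma class_straight d : c (straight G d) = c d.
Proof. by rewrite -translate10 class_translate. Qed.

Lemma mem_vtx d : d \in vtx d. Proof. exact: porbit_id. Qed.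

Lemma eq_vtx d e : (vtx d == vtx e) = (d \in vtx e).
Proof. by rewrite /vtx eq_porbit_mem. Qed.

Lemma vtx_ccw d : vtx (rho d) = vtx d.
Proof. by apply/eqP; rewrite eq_vtx; apply: (mem_porbit rho 1). Qed.

Lemma vtx_half_turn d : vtx (half_turn d) = vtx d.
Proof. by rewrite /half_turn !vtx_ccw. Qed.

Lemma vtx_dopp d : vtx (tau d) = vtx (straight G d).
Proof. by rewrite dopp_half_turn // translate10 vtx_half_turn. Qed.

(** The six powers of [rho] are split as an optional half-turn followed by 0, 1 or 2 turns; the
    number of turns is visible in the class. *)
Lemma vtxP d e : vtx e = vtx d ->
  exists2 d', d' = d \/ d' = half_turn d
             & [\/ e = d', e = rho d' | e = rho (rho d')].
Proof.
move/eqP; rewrite eq_vtx => /porbitP [i ->].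
have -> : (rho ^+ i = rho ^+ (i %% 6))%g.
  by rewrite {1}(divn_eq i 6) expgD mulnC expgM ccw6 expg1n mul1g.
have: (i %% 6 < 6)%N by rewrite ltn_mod.
case: (i %% 6)%N => [|[|[|[|[|[|//]]]]]] _; rewrite permX /=.
- by exists d; [left | constructor].
- by exists d; [left | constructor 2].
- by exists d; [left | constructor 3].
- by exists (half_turn d); [right | constructor].
- by exists (half_turn d); [right | constructor 2].
- by exists (half_turn d); [right | constructor 3].
Qed.

Lemma eq_vtx_class d e : vtx e = vtx d -> c e = c d -> e = d \/ e = half_turn d.
Proof.
case/vtxP=> d' dd'; have <- : c d' = c d by case: dd' => ->; rewrite ?class_half_turn.
case=> -> //; rewrite !class_ccw => /eqP; first by rewrite Z3_add1_neq.
by rewrite Z3_add2_neq.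
Qed.

(** The darts [d], [rho d] and [rho (rho d)] have distinct classes, so coincidences among the six
    rotated darts come only from a trivial half-turn. *)
Lemma card_vtx d : #|vtx d| = if half_turn d == d then 3%N else 6%N.
Proof.
pose s d := [:: d; rho d; rho (rho d)].
have cN1 e : c e + 1 <> c e by apply/eqP; rewrite Z3_add1_neq.
have cN2 e : c e + 1 + 1 <> c e by apply/eqP; rewrite Z3_add2_neq.
have us e : uniq (s e).
  rewrite /= !inE negb_or andbT -andbA; apply/and3P.
  by split; apply/eqP => /(congr1 c); rewrite !class_ccw;
     apply/eqP; rewrite eq_sym ?Z3_add1_neq ?Z3_add2_neq.
have sub e : e \in vtx d -> e \in s d ++ s (half_turn d).
  rewrite -eq_vtx => /eqP/vtxP [d' dd'].
  by case: dd' => ->; rewrite mem_cat !inE; case=> ->; rewrite eqxx ?orbT.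
have sup e : e \in s d ++ s (half_turn d) -> e \in vtx d.
  by rewrite mem_cat !inE -eq_vtx -!orbA
    => /or4P [|||/or3P []] /eqP ->; rewrite ?vtx_ccw ?vtx_half_turn.
case: eqP => hd.
  rewrite -[RHS]/(size (s d)) -(card_uniqP (us d)); apply: eq_card => e; apply/idP/idP => [/sub|He].
    by rewrite hd mem_cat orbb.
  by apply: sup; rewrite mem_cat He.
have u6 : uniq (s d ++ s (half_turn d)).
  rewrite cat_uniq !us andbT andTb; apply/hasPn => e; rewrite /= !inE => He.
  case/or3P: He => /eqP ->; rewrite !negb_or; apply/and3P; split;
    try (by apply/eqP => /(congr1 c); rewrite !(class_ccw, class_half_turn) => /eqP;
            case: (c d) => [[|[|[|?]]] ?]);
    by apply/eqP; do ?move/perm_inj.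
rewrite -[RHS]/(size (s d ++ s (half_turn d))) -(card_uniqP u6).
by apply: eq_card => e; apply/idP/idP => [/sub|/sup].
Qed.

Lemma card_vtx3 d : (#|vtx d| = 3%N) <-> half_turn d = d.
Proof. by rewrite card_vtx; case: eqP. Qed.

End Vertices.

(** * Maximal class paths *)

Section Paths.

Variables (G : graph_map) (c : dart G -> 'Z_3).
Hypothesis ccw6 : (ccw G ^+ 6 = 1)%g.
Hypothesis face3 : (face_perm G ^+ 3 = 1)%g.
Hypothesis cP : class_partition c.
Implicit Types d e : dart G.

Local Notation rho := (ccw G).
Local Notation tau := (dopp G).
Local Notation adv := (straight G).

Lemma half_turn_fixed d a b : half_turn d = d ->
  half_turn (translate d a b) = translate d (- a) (- b).
Proof. by move=> hd; rewrite half_turn_translate // hd. Qed.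

Lemma dopp_translate d a b : half_turn d = d ->
  tau (translate d a b) = translate d (- a - 1) (- b).
Proof.
move=> hd; rewrite dopp_half_turn // translateD // half_turn_fixed //.
by congr translate; lia.
Qed.

Lemma dopp_ccw_translate d a b : half_turn d = d ->
  tau (rho (translate d a b)) = rho (translate d (- a) (- b - 1)).
Proof.
move=> hd; rewrite dopp_half_turn // translate_ccw // translateD //.
rewrite -[half_turn _]/(rho (half_turn _)) half_turn_fixed //.
by congr (rho (translate _ _ _)); lia.
Qed.

Lemma dopp_ccw2_translate d a b : half_turn d = d ->
  tau (rho (rho (translate d a b))) = rho (rho (translate d (- a + 1) (- b - 1))).
Proof.
move=> hd; rewrite dopp_half_turn // !translate_ccw // translateD //.
rewrite -[half_turn _]/(rho (rho (half_turn _))) half_turn_fixed //.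
by congr (rho (rho (translate _ _ _))); lia.
Qed.

(* A translation by an odd vector followed by the half-turn about [d] is the
   half-turn about the midpoint of an edge, which [dopp_neq] forbids. *)
Lemma translate_fixed_even d a b : half_turn d = d -> translate d a b = d ->
  exists x y, [/\ a = 2 * x, b = 2 * y
                & half_turn (translate d x y) = translate d x y].
Proof.
move=> hd td.
have shift x y : translate d (x - a) (y - b) = translate d x y.
  by rewrite -[in LHS]td translateD //; congr translate; lia.
have parity n : exists z : int, n = 2 * z \/ n = 2 * z + 1.
  exists (n %/ 2)%Z; have := divz_eq n 2; have := modz_ge0 n (isT : 2 != 0 :> int).
  have := ltz_pmod n (isT : 0 < 2 :> int); lia.
have [x Ea] := parity a; have [y Eb] := parity b; case: Ea Eb => [Ea|Ea] [Eb|Eb].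
- exists x, y; split=> //; rewrite half_turn_fixed // -(shift x y).
  by congr translate; lia.
- have /eqP[] := dopp_neq (rho (translate d x y)).
  rewrite dopp_ccw_translate // -(shift x y); congr (rho (translate _ _ _)); lia.
- have /eqP[] := dopp_neq (translate d x y).
  rewrite dopp_translate // -(shift x y); congr translate; lia.
- have /eqP[] := dopp_neq (rho (rho (translate d (x + 1) y))).
  rewrite dopp_ccw2_translate // -(shift (x + 1) y).
  congr (rho (rho (translate _ _ _))); lia.
Qed.

Definition ray d m : seq (dart G) := mkseq (fun i => iter i adv d) m.

(** The distance to the next vertex of degree 3 straight ahead. The walk turns back there, so it
    returns to a dart [d] fixed by the half-turn after exactly [2 * m] steps. *)
Definition half_period d m : Prop :=
  [/\ (0 < m)%N, half_turn (iter m adv d) = iter m adv d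
    & forall i, (0 < i < m)%N -> half_turn (iter i adv d) <> iter i adv d].

Lemma half_period_exists d : half_turn d = d -> exists m, half_period d m.
Proof.
move=> hd.
pose P m := (0 < m)%N && (half_turn (iter m adv d) == iter m adv d).
have exP : exists m, P m.
  exists #[adv]%g; rewrite /P order_gt0 /= -permX expg_order perm1.
  exact/eqP.
exists (ex_minn exP); case: ex_minnP => m /andP [m0 /eqP hm] minm; split=> //.
move=> i /andP [i0 im] hi; have: P i by rewrite /P i0; apply/eqP.
by move/minm; rewrite leqNgt im.
Qed.

Lemma path_vertices_ray d m : (0 < m)%N ->
  path_vertices (ray d m) = mkseq (fun i => vtx (iter i adv d)) m.+1.
Proof.
case: m => // m _.
have -> : mkseq (fun i => vtx (iter i adv d)) m.+2
          = vtx d :: [seq vtx (iter i.+1 adv d) | i <- iota 0 m.+1].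
  rewrite /mkseq -[iota 0 m.+2]/(0%N :: iota (1 + 0) m.+1) iotaDl /= -map_comp.
  by [].
rewrite -[LHS]/(vtx d :: [seq vtx (tau e) | e <- ray d m.+1]) /ray /mkseq -map_comp.
by congr (_ :: _); apply: eq_map => i /=; rewrite vtx_dopp.
Qed.

(** By [translate_fixed_even] a period is even and half of it leads to a vertex of degree 3. *)
Lemma half_period_le d m l : half_turn d = d -> half_period d m -> (0 < l)%N ->
  iter l adv d = d -> (m.*2 <= l)%N.
Proof.
move=> hd [_ _ mP] l0; rewrite -translate_nat => /(translate_fixed_even hd) [x [y [El E0 hx]]].
have Ex : x = `|x|%N by lia.
rewrite leqNgt; apply/negP => lm.
have y0 : y = 0 by lia.
move: hx; rewrite Ex y0 translate_nat; apply: mP; lia.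
Qed.

(** Two darts of the walk at the same vertex are equal or differ by a half-turn; then the walk has
    period [j - i] or [j + i], and both are less than [2 * m]. *)
Lemma ray_vtx_inj d m i j : half_turn d = d -> half_period d m ->
  (i <= m)%N -> (j <= m)%N -> vtx (iter i adv d) = vtx (iter j adv d) -> i = j.
Proof.
move=> hd hm; wlog ij : i j / (i < j)%N.
  move=> H im jm E; case: (ltngtP i j) => // ij; first exact: H.
  by apply/esym/H.
move=> im jm E; exfalso.
have cE k : c (iter k adv d) = c d by rewrite -translate_nat class_translate.
have shift a l : translate d a 0 = translate d (a + l%:Z) 0 -> iter l adv d = d.
  move/(congr1 (fun e => translate e (- a) 0)); rewrite !translateD // subrr !addr0.
  by rewrite translate0 [a + _]addrC addrK translate_nat.
have low l : (0 < l < m.*2)%N -> iter l adv d <> d.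
  by case/andP=> l0 lm /(half_period_le hd hm l0); rewrite leqNgt lm.
move: (eq_vtx_class ccw6 cP E); rewrite !cE => /(_ erefl).
rewrite -!translate_nat half_turn_fixed // oppr0; case=> [Eij|/esym Eij].
- apply: (low (j - i)%N); first by lia.
  by apply: (shift i%:Z); rewrite Eij; congr translate; lia.
- apply: (low (j + i)%N); first by lia.
  by apply: (shift (- j%:Z)); rewrite Eij; congr translate; lia.
Qed.

Lemma path_vertices_cat w1 d w2 :
  sorted (fun d e => vtx (tau d) == vtx e) (w1 ++ d :: w2) ->
  path_vertices (w1 ++ d :: w2)
  = [seq vtx e | e <- w1] ++ vtx d :: [seq vtx (tau e) | e <- d :: w2].
Proof.
elim: w1 => [//|x [|y w1] IH] /= /andP [/eqP Exy]; first by rewrite Exy.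
by move/IH; rewrite /= Exy => ->.
Qed.

Lemma ray_class_path d m : half_turn d = d -> half_period d m ->
  class_path c (c d) (ray d m).
Proof.
move=> hd hm; have [m0 _ _] := hm; apply/andP; split; last first.
  by apply/allP => _ /mapP [i _ ->]; rewrite -translate_nat class_translate.
rewrite /is_path path_vertices_ray // -size_eq0 size_mkseq -lt0n m0 andTb; apply/andP; split.
  apply/(sortedP d) => i; rewrite size_mkseq => im.
  by rewrite !nth_mkseq ?vtx_dopp // (ltnW im).
apply/mkseq_uniqP => i j im jm; exact: (ray_vtx_inj hd hm).
Qed.

(** By its vertex and class, the next dart is [adv d] or the half-turn of it; the latter is [tau d],
    which would lead back to a vertex already visited. *)
Lemma class_path_next q w w1 w2 d e : class_path c q w ->
  w = w1 ++ [:: d, e & w2] -> e = adv d.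
Proof.
case/andP=> /and3P [_ sw uw] /allP cw Ew.
have cd : c d = q by apply/eqP/cw; rewrite Ew mem_cat !inE eqxx !orbT.
have ce : c e = q by apply/eqP/cw; rewrite Ew mem_cat !inE eqxx !orbT.
have Ede : vtx e = vtx (adv d).
  move: sw; rewrite Ew; case: {uw Ew cw}w1 => [|x w1] /=.
    by case/andP => /eqP <- _; rewrite vtx_dopp.
  by rewrite cat_path /= => /and3P [_ _ /andP [/eqP <- _]]; rewrite vtx_dopp.
have [|//|He] := eq_vtx_class ccw6 cP Ede; first by rewrite class_straight // ce.
move: uw; rewrite Ew path_vertices_cat -?Ew // cat_uniq => /and3P [_ _].
have -> : e = tau d by rewrite He dopp_half_turn // translate10.
by rewrite /= doppK !inE eqxx !orbT.
Qed.

Lemma class_path_ray q w d : class_path c q w -> ohead w = Some d -> w = ray d (size w).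
Proof.
move=> cw; case: w cw => // x w cw [Ex]; rewrite -{}Ex.
apply: (@eq_from_nth _ x); rewrite ?size_mkseq // => i.
elim: i => [//|i IH] Hi; rewrite nth_mkseq //= -[iter i _ _](nth_mkseq x _ (ltnW Hi)).
rewrite -/(ray x (size (x :: w))) -IH ?(ltnW Hi) //.
apply: (class_path_next (w1 := take i (x :: w)) (w2 := drop i.+2 (x :: w)) cw).
by rewrite -drop_nth // -drop_nth ?(ltnW Hi) // cat_take_drop.
Qed.

(** At a vertex of degree 3, straight ahead means back along the same edge. *)
Lemma class_path_degree6 q w w1 w2 d e : class_path c q w ->
  w = w1 ++ [:: d, e & w2] -> half_turn e <> e.
Proof.
move=> cw Ew he; have Ede := class_path_next cw Ew.
have Ed : d = tau e.
  by rewrite -[d]doppK; congr (tau _); rewrite dopp_half_turn // translate10 -Ede.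
case/andP: cw => /and3P [_ sw uw] _; move: uw.
rewrite Ew path_vertices_cat -?Ew // cat_uniq => /and3P [_ _].
by rewrite Ed /= !inE eqxx !orbT.
Qed.

(** An extension on either side would make an end of degree 3 an inner vertex, against
    [class_path_degree6]. *)
Lemma ray_maximal d m : half_turn d = d -> half_period d m ->
  maximal_class_path c (c d) (ray d m).
Proof.
move=> hd hm; have [m0 hdm _] := hm; split; first exact: ray_class_path.
move=> w cw /infixP [w1 [w2 Ew]].
have w1nil : w1 = [::].
  case/lastP: w1 Ew => // w1 x; rewrite cat_rcons.
  case: m m0 {hm hdm} => // m _; rewrite {1}/ray {1}/mkseq /= => Ew.
  by case: (class_path_degree6 cw Ew).
have w2nil : w2 = [::].
  case: w2 Ew => // y w2.
  case: m m0 hdm {hm} => // m _ hdm; rewrite /ray mkseqS cat_rcons catA => Ew.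
  by case: (class_path_degree6 cw Ew); rewrite (class_path_next cw Ew).
by rewrite Ew w1nil w2nil cats0.
Qed.

Lemma path_from_ray d m : half_turn d = d -> half_period d m ->
  path_from c (vtx d) (c d) (ray d m).
Proof.
move=> hd hm; have [m0 _ _] := hm; split.
- exact: imset_f.
- exact/(card_vtx3 ccw6 cP).
- exact: ray_maximal.
- by rewrite path_vertices_ray // nth_mkseq.
Qed.

(** A class path starting with [d] is an initial part of the straight walk, so [w] and the maximal
    path [ray d m] are comparable; maximality of the shorter one gives equality. *)
Lemma path_fromP A q w : path_from c A q w ->
  exists d m, [/\ half_turn d = d, c d = q, vtx d = A, half_period d m & w = ray d m].
Proof.
case=> Avtx A3 [cw maxw]; case: w cw maxw => [|d w] cw maxw; first by case/andP: cw.
rewrite [nth _ _ _]/= => EA.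
have cd : c d = q by case/andP: (cw) => _ /andP [/eqP].
have hd : half_turn d = d by apply/(card_vtx3 ccw6 cP); rewrite EA.
have [m hm] := half_period_exists hd; exists d, m; split=> //.
have Ew : d :: w = ray d (size (d :: w)) by apply: class_path_ray cw _.
have prefix_ray i j : (i <= j)%N -> infix (ray d i) (ray d j).
  move=> ij; apply: prefixW; apply/prefixP.
  exists [seq iter l adv d | l <- iota i (j - i)].
  by rewrite /ray /mkseq -map_cat -[in X in _ ++ X](add0n i) -iotaD subnKC.
case: (leqP m (size (d :: w))) => le.
  have [_] := ray_maximal hd hm; rewrite cd; apply=> //.
  by rewrite {1}Ew; apply: prefix_ray.
symmetry; apply: maxw; first by rewrite -cd; apply: ray_class_path.
by rewrite Ew; apply: prefix_ray; apply: ltnW.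
Qed.

End Paths.

(** * Index-vectors from lattices *)

Definition lattice (k m s : nat) (a b : int) : Prop :=
  exists x y : int, a = x * m%:Z + y * s%:Z /\ b = y * k%:Z.

Lemma mulz_small (x : int) (n : nat) (y : int) :
  y = x * n%:Z -> - n%:Z < y < n%:Z -> x = 0 /\ y = 0.
Proof.
move=> -> /andP [H1 H2]; suff x0 : x = 0 by rewrite x0 mul0r.
have [|[|//]] : x <= -1 \/ 1 <= x \/ x = 0 by lia.
all: nia.
Qed.

Section Index.

Variables (G : graph_map) (c : dart G -> 'Z_3).
Hypothesis ccw6 : (ccw G ^+ 6 = 1)%g.
Hypothesis face3 : (face_perm G ^+ 3 = 1)%g.
Hypothesis cP : class_partition c.
Implicit Types e f g : dart G.

Local Notation rho := (ccw G).
Local Notation tau := (dopp G).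
Local Notation adv := (straight G).

Lemma edgeP e f : reflect (e = f \/ e = tau f) (e \in edge f).
Proof.
rewrite /edge; apply: (iffP (porbitP _ _ _)) => [[i ->]|[->|->]].
- rewrite permX; elim: i => [|i [] IH] /=; [by left|by right; rewrite IH|left].
  by rewrite IH doppK.
- by exists 0%N; rewrite expg0 perm1.
- by exists 1%N; rewrite expg1.
Qed.

Lemma eq_edge e f : edge e = edge f -> e = f \/ e = tau f.
Proof. by move=> E; apply/edgeP; rewrite -E; apply/edgeP; left. Qed.

Lemma edge_dopp e : edge (tau e) = edge e.
Proof.
by apply/eqP; rewrite /edge eq_porbit_mem -/(edge _); apply/edgeP; right.
Qed.

Lemma path_edges_class q w e : all (fun e => c e == q) w -> c e != q ->
  edge e \notin path_edges w.
Proof.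
move=> /allP cw ce; apply/imsetP => -[f fw /eq_edge Ef].
by move: (cw f fw) ce => /eqP <-; case: Ef => ->; rewrite ?class_dopp // eqxx.
Qed.

Lemma is_dist_unique (U W : seq {set dart G}) k1 k2 :
  is_dist U W k1 -> is_dist U W k2 -> k1 = k2.
Proof.
have le k k' : is_dist U W k -> is_dist U W k' -> (k <= k')%N.
  by case=> _ H [[A [w [AU Aw wW <-]]] _]; apply: H Aw wW.
by move=> H1 H2; apply/eqP; rewrite eqn_leq !le.
Qed.

Variable d : dart G.
Hypothesis hd : half_turn d = d.
Local Notation D := (translate d).

Lemma iter_straight_translate a b i : iter i adv (D a b) = D (a + i%:Z) b.
Proof. by rewrite -translate_nat translateD // addr0. Qed.

Lemma iter_straight_ccw a b i : iter i adv (rho (D a b)) = rho (D a (b + i%:Z)).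
Proof. by rewrite -translate_nat translate_ccw // translateD // oppr0 !addr0. Qed.

(** Call [b] the height of [translate d a b]. Up to sign, an edge changes the height by at most 1;
    this yields the lower bound for the distance K(q). *)
Lemma vtx_dopp_translate e a b : vtx e = vtx (D a b) ->
  exists a' b' : int, vtx (tau e) = vtx (D a' b') /\ (`|b'| <= `|b| + 1)%N.
Proof.
case/(vtxP ccw6) => e' Ee'.
have {Ee'} [x [y [-> Ey]]] : exists x y : int, e' = D x y /\ (y = b \/ y = - b).
  case: Ee' => ->; [exists a, b|exists (- a), (- b)]; first by split; [|left].
  by rewrite half_turn_fixed //; split; [|right].
case=> ->.
- by exists (- x - 1), (- y); rewrite dopp_translate //; split=> //; lia.
- by exists (- x), (- y - 1); rewrite dopp_ccw_translate // vtx_ccw; split=> //; lia.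
- exists (- x + 1), (- y - 1); rewrite dopp_ccw2_translate // !vtx_ccw; split=> //; lia.
Qed.

Lemma adjv_path_translate A w a b : A = vtx (D a b) -> path (@adjv G) A w ->
  exists a' b' : int, last A w = vtx (D a' b') /\ (`|b'| <= `|b| + size w)%N.
Proof.
elim: w A a b => [|B w IH] A a b EA /=; first by exists a, b; rewrite addn0.
case/andP => /existsP [e /andP [/eqP Ee /eqP Ee']] Bw.
have [a1 [b1 [E1 le1]]] := vtx_dopp_translate (etrans Ee EA).
have [a2 [b2 [E2 le2]]] := IH B a1 b1 (etrans (esym Ee') E1) Bw.
by exists a2, b2; split=> //; lia.
Qed.

Lemma connected_translate e : connected G -> exists a b, vtx e = vtx (D a b).
Proof.
have vin f : vtx f \in vertices G by apply: imset_f.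
move=> /(_ _ _ (vin d) (vin e)) /connectP [w dw ->].
have {}dw : path (@adjv G) (vtx d) w by apply: sub_path dw => A B /and3P [].
have [a [b [-> _]]] := adjv_path_translate (congr1 _ (esym (translate0 d))) dw.
by exists a, b.
Qed.

(** * The index-vector computed from a dart with a given lattice *)

Variables k m s : nat.
Hypotheses (k_gt0 : (0 < k)%N) (s_lt_m : (s < m)%N).
Hypothesis latticeP : forall a b, half_turn (D a b) = D a b <-> lattice k m s a b.

Lemma latticeD a b a' b' : lattice k m s a' b' ->
  lattice k m s (a + a') (b + b') <-> lattice k m s a b.
Proof.
case=> x' [y' [-> ->]]; split=> -[x [y [Ea Eb]]].
- by exists (x - x'), (y - y'); rewrite !mulrBl; split; lia.
- by exists (x + x'), (y + y'); rewrite !mulrDl; split; lia.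
Qed.

(** The stabilizer of [d] is twice the lattice: by [translate_fixed_even] a period is twice a vector
    leading to a vertex of degree 3. *)
Lemma translate_eq a b a' b' : D a b = D a' b' <->
  exists x y : int, a = a' + 2 * (x * m%:Z + y * s%:Z) /\ b = b' + 2 * (y * k%:Z).
Proof.
split=> [E|[x [y [-> ->]]]].
- have: D (a - a') (b - b') = d.
    by rewrite -translateD // E translateD // !subrr translate0.
  case/(translate_fixed_even ccw6 face3 hd) => u [v [Eu Ev]].
  by case/latticeP => x [y [Exu Eyv]]; exists x, y; split; lia.
- set u := x * _ + _; set v := y * _.
  have /latticeP : lattice k m s u v by exists x, y.
  rewrite half_turn_fixed // => /(congr1 (fun e => translate e (a' + u) (b' + v))).
  rewrite !translateD // => E.
  transitivity (D (u + (a' + u)) (v + (b' + v))); first by congr translate; lia.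
  by rewrite -E; congr translate; lia.
Qed.

(** Vertices are the points of Z[w] up to translations by twice the lattice and the half-turn about
    [d]. *)
Lemma vtx_translate_eq a b a' b' : vtx (D a b) = vtx (D a' b') <->
  exists x y : int, (a = a' + 2 * (x * m%:Z + y * s%:Z) /\ b = b' + 2 * (y * k%:Z)) \/
                    (a = - a' + 2 * (x * m%:Z + y * s%:Z) /\ b = - b' + 2 * (y * k%:Z)).
Proof.
split=> [E|[x [y H]]].
- have [|E'|E'] := eq_vtx_class ccw6 cP E; first by rewrite !class_translate.
  + by move/translate_eq: E' => [x [y H]]; exists x, y; left.
  + rewrite half_turn_fixed // in E'.
    by move/translate_eq: E' => [x [y H]]; exists x, y; right.
case: H => H; first by congr vtx; apply/translate_eq; exists x, y.
rewrite -[RHS]vtx_half_turn half_turn_fixed //; congr vtx.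
by apply/translate_eq; exists x, y.
Qed.

Let m_gt0 : (0 < m)%N. Proof. exact: leq_ltn_trans s_lt_m. Qed.

Lemma half_period_translate a b : lattice k m s a b -> half_period (D a b) m.
Proof.
move=> Lab; split=> // [|i /andP [i0 im]]; rewrite iter_straight_translate.
- apply/latticeP; rewrite addrC -[b]add0r latticeD //.
  by exists 1, 0; rewrite mul1r !mul0r addr0.
- move=> /latticeP; rewrite addrC -[b]add0r latticeD // => -[x [y [Ei Ey]]].
  have y0 : y = 0 by nia.
  rewrite y0 mul0r addr0 in Ei; have := mulz_small Ei; lia.
Qed.

Lemma half_period_base : half_period d m.
Proof.
by rewrite -(translate0 d); apply: half_period_translate; exists 0, 0; rewrite !mul0r addr0.
Qed.

(** A path in direction w between vertices of degree 3 climbs by a multiple of [k]. This makes the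
    path of class q + 1 long enough to reach the base path. *)
Lemma half_period_ccw a b l : lattice k m s a b -> half_period (rho (D a b)) l -> (k <= l)%N.
Proof.
move=> Lab [l0 + _]; rewrite iter_straight_ccw => /perm_inj/latticeP.
rewrite [b + _]addrC -[a]add0r latticeD // => -[x [y [_ El]]].
have y0 : 0 < y by nia.
nia.
Qed.

Lemma mem_path_vertices_ray g l A : (0 < l)%N ->
  reflect (exists2 i, (i <= l)%N & A = vtx (iter i adv g)) (A \in path_vertices (ray g l)).
Proof.
move=> l0; rewrite path_vertices_ray //; apply: (iffP mapP) => [[i]|[i il EA]].
  by rewrite mem_iota => il EA; exists i.
by exists i; rewrite ?mem_iota.
Qed.

Lemma path_vertices_base_height a b :
  vtx (D a b) \in path_vertices (ray d m) -> exists y : int, b = y * (k.*2)%:Z.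
Proof.
case/(mem_path_vertices_ray _ _ m_gt0) => i _.
rewrite -translate_nat => /vtx_translate_eq [x [y [[_ ->]|[_ ->]]]]; exists y; lia.
Qed.

(* The two ends of the maximal path opposite to [ray d m] are the translates by
   [(- s, - k)] and, for [eps = true], by [(- s - m, - k)]. *)
Variable eps : bool.
Local Notation a0 := (s%:Z + (eps * m)%N%:Z).
Local Notation g := (D (- a0) (- k%:Z)).

Lemma lattice_opposite : lattice k m s (- a0) (- k%:Z).
Proof. by exists (- eps%:Z), (- 1); split; lia. Qed.

Lemma path_edges_opposite : path_edges (ray d m) != path_edges (ray g m).
Proof.
have ed : edge d \in path_edges (ray d m).
  by apply: imset_f; apply/mapP; exists 0%N; rewrite ?mem_iota.
apply/eqP => E; move: ed; rewrite E => /imsetP [_ /mapP [i _ ->]].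
rewrite iter_straight_translate => /eq_edge; rewrite dopp_translate //.
(* Modulo [2 * k] the heights of the two paths are 0 and [k]. *)
have odd y : k%:Z <> 2 * (y * k%:Z) by case: (ltrgtP y 0) => ?; nia.
case; rewrite -[LHS]translate0 => /translate_eq [x [y [_ E0]]].
  by apply: (odd y); lia.
by apply: (odd (- y)); lia.
Qed.

Lemma opposite_foot : vtx (D a0 0) \in path_vertices (ray d m).
Proof.
apply/mem_path_vertices_ray => //.
have le : (s + eps * m <= m \/ s + eps * m = m + s)%N by case: eps; lia.
(* Past its end, at position [m], the walk retraces the path, so position [m + s] is the vertex at
   position [m - s]. *)
exists (if (s + eps * m <= m)%N then s + eps * m else m - s)%N; first by case: ifP; lia.
rewrite -translate_nat; apply/vtx_translate_eq.
by case: ifP => ?; [exists 0, 0; left | exists 1, 0; right]; split; lia.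
Qed.

(** Upper bound: [k] steps in direction - w. Lower bound: heights change by at most 1 per step, and
    those of the opposite path are odd multiples of [k]. *)
Lemma is_dist_opposite : is_dist (path_vertices (ray d m)) (path_vertices (ray g m)) k.
Proof.
split.
  exists (vtx (D (- a0) 0)), (mkseq (fun i => vtx (D (- a0) (- i.+1%:Z))) k); split.
  - by rewrite -vtx_half_turn half_turn_fixed // opprK oppr0; apply: opposite_foot.
  - apply/(pathP set0) => i; rewrite size_mkseq => ik.
    have -> : nth set0 (vtx (D (- a0) 0) :: mkseq (fun i => vtx (D (- a0) (- i.+1%:Z))) k) i
              = vtx (D (- a0) (- i%:Z)).
      by case: i ik => [|i] ik /=; rewrite ?oppr0 // nth_mkseq // ltnW.
    rewrite nth_mkseq //; apply/existsP; exists (rho (half_turn (D (- a0) (- i%:Z)))).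
    rewrite vtx_ccw vtx_half_turn eqxx half_turn_fixed // dopp_ccw_translate // vtx_ccw.
    by apply/eqP; congr (vtx (translate _ _ _)); lia.
  - rewrite -{1}(prednK k_gt0) mkseqS last_rcons prednK //.
    by apply/mem_path_vertices_ray => //; exists 0%N.
  - by rewrite size_mkseq.
move=> A w /(mem_path_vertices_ray _ _ m_gt0) [i _]; rewrite -translate_nat => EA Aw.
have [a [b [-> le]]] := adjv_path_translate EA Aw.
case/(mem_path_vertices_ray _ _ m_gt0) => j _; rewrite iter_straight_translate.
case/vtx_translate_eq => x [y H].
have {}H : b = (2 * y - 1) * k%:Z \/ b = (2 * y + 1) * k%:Z by lia.
apply: leq_trans le; suff : b <= - k%:Z \/ k%:Z <= b by lia.
have [|[y0|]] : y <= -1 \/ y = 0 \/ 1 <= y by lia.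
- by case: H => -> y0; left; nia.
- by case: H => ->; rewrite y0; [left|right]; lia.
- by case: H => -> y0; right; nia.
Qed.

Variable l : nat.
Hypothesis l_period : half_period (rho g) l.
Local Notation p := (ray d m).
Local Notation t := (ray (rho g) l).

Let k_le_l : (k <= l)%N.
Proof. exact: half_period_ccw lattice_opposite l_period. Qed.

(** The edge of [t] that arrives at the base path, directed towards that path in [f0] and away from
    it in [e0]. *)
Let f0 := rho (D (- a0) (- 1)).
Let e0 := rho (D a0 0).

Let dopp_f0 : tau f0 = e0.
Proof.
by rewrite /f0 dopp_ccw_translate // opprK; congr (rho (translate _ _ _)); lia.
Qed.

Lemma not_mem_path_vertices_base a b : 0 < b < (k.*2)%:Z ->
  vtx (D a b) \notin path_vertices p /\ vtx (D a (- b)) \notin path_vertices p.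
Proof.
by move=> Hb; split; apply/negP => /path_vertices_base_height [y /mulz_small]; lia.
Qed.

Lemma path_edges_base e : c e != c d -> edge e \notin path_edges p.
Proof.
move=> ce; apply: path_edges_class ce.
by have /andP [] := ray_class_path ccw6 face3 cP hd half_period_base.
Qed.

Lemma path_edges_base_ccw a b : edge (rho (D a b)) \notin path_edges p.
Proof. by apply: path_edges_base; rewrite class_ccw // class_translate // Z3_add1_neq. Qed.

(** The dart of index [i] leads from height [- (k - i)] to height [- (k - i - 1)], and the vertices
    of [p] have heights divisible by [2 * k]. *)
Lemma adjacent_transversal i : (i < k)%N ->
  adjacent p (iter i adv (rho g)) = (i == k.-1).
Proof.
move=> ik; rewrite iter_straight_ccw /adjacent path_edges_base_ccw andTb.
have -> : - k%:Z + i%:Z = - (k - i)%N%:Z by lia.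
set f := rho _; have Etau : tau f = rho (D a0 (k - i.+1)%N%:Z).
  by rewrite /f dopp_ccw_translate //; congr (rho (translate _ _ _)); lia.
have Nf : vtx f \notin path_vertices p.
  by rewrite vtx_ccw; apply: (not_mem_path_vertices_base _ _).2; lia.
apply/existsP/eqP => [[e /andP [/edgeP Ee pe]]|Ei].
  case: Ee pe => ->; first by rewrite (negbTE Nf).
  rewrite Etau vtx_ccw; case: (ltnP i k.-1) => ik' He; last by lia.
  have : 0 < (k - i.+1)%N%:Z < (k.*2)%:Z by lia.
  by case/(not_mem_path_vertices_base a0); rewrite He.
exists (tau f); rewrite Etau vtx_ccw; apply/andP; split.
  by rewrite -Etau; apply/edgeP; right.
have -> : (k - i.+1)%N%:Z = 0 by lia.
exact: opposite_foot.
Qed.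

Lemma first_adjacent_transversal f : first_adjacent p t f <-> f = f0.
Proof.
have k1l : (k.-1 < l)%N by rewrite prednK.
have Ef0 : iter k.-1 adv (rho g) = f0.
  by rewrite iter_straight_ccw; congr (rho (translate _ _ _)); lia.
have nth_t i : (i < l)%N -> nth f t i = iter i adv (rho g) by apply: nth_mkseq.
split=> [[t1 [t2 [Et adj_f adj_t1]]]|->].
  have st1 : (size t1 < l)%N.
    by rewrite -[l](size_mkseq (fun i => iter i adv (rho g))) -/t Et size_cat /= -addSnnS leq_addr.
  have Ef : f = iter (size t1) adv (rho g).
    by rewrite -nth_t // Et nth_cat ltnn subnn.
  have t1k : (size t1 <= k.-1)%N.
    rewrite leqNgt; apply/negP => lt; case/hasP: adj_t1.
    exists (nth f t1 k.-1); first exact: mem_nth.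
    have -> : nth f t1 k.-1 = nth f t k.-1 by rewrite Et nth_cat lt.
    by rewrite nth_t // adjacent_transversal ?eqxx // prednK.
  move: adj_f; rewrite {1}Ef adjacent_transversal; last by rewrite -(prednK k_gt0) ltnS.
  by move/eqP => Es; rewrite Ef Es.
exists (take k.-1 t), (drop k t); split.
- have -> : f0 :: drop k t = drop k.-1 t.
    by rewrite [RHS](drop_nth f0) ?size_mkseq // nth_mkseq // Ef0 prednK.
  by rewrite cat_take_drop.
- by rewrite -Ef0 adjacent_transversal ?eqxx // prednK.
- apply/hasPn => e /(nthP e) [i]; rewrite size_takel ?size_mkseq ?(ltnW k1l) // => ik.
  rewrite nth_take // nth_mkseq ?(ltn_trans ik) // => <-.
  by rewrite adjacent_transversal ?(ltn_eqF ik) // (leq_trans ik) // leq_pred.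
Qed.

(** For [eps = false] the branch is a left one at position [s]. For [eps = true] it is a right one
    at position [m - s], and 2 m - (m - s) - m = s. Hence the choice of the end C does not
    matter. *)
Lemma branch_shift_transversal j : adjacent_at p j e0 -> branch_shift p j e0 = s%:Z.
Proof.
case/and3P => _; rewrite size_mkseq => jm.
rewrite path_vertices_ray // nth_mkseq // /e0 vtx_ccw -translate_nat => /eqP Ej.
have {}Ej : j = (if eps then m - s else s)%N.
  move/vtx_translate_eq: Ej => [x [y H]].
  have [y0 _] : y = 0 /\ 0 = 0 :> int by apply: (@mulz_small _ k); lia.
  rewrite y0 mul0r addr0 in H.
  (* Two positions giving the same vertex have a difference or a sum divisible by [2 * m]. *)
  have Ex : eps%:Z * m%:Z + s%:Z - j%:Z = x * (m.*2)%:Z \/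
            eps%:Z * m%:Z + s%:Z + j%:Z = x * (m.*2)%:Z.
    by case: H => -[H _]; [left|right]; case: (eps) H; lia.
  have Hx : x <= -1 \/ x = 0 \/ x = 1 \/ 2 <= x by lia.
  by case: Hx => [|[|[|]]] Hx; case: Ex => Ex; case: (eps) Ex => Ex; nia.
rewrite /branch_shift /branch_index size_mkseq.
have -> : left_branch p j e0 = ~~ eps.
  rewrite /left_branch size_mkseq; case: (boolP eps) Ej => /= [Heps Ej|/negbTE Heps Ej].
    apply/norP; split; apply/negP => /andP [Hj /eqP].
      rewrite nth_mkseq // -translate_nat => /perm_inj/translate_eq [x [y [Ea Eb]]].
      have [y0 _] : y = 0 /\ 0 = 0 :> int by apply: (@mulz_small _ k); lia.
      rewrite y0 mul0r addr0 Heps in Ea.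
      have [_] : x + 1 = 0 /\ m%:Z - s%:Z = 0 by apply: (@mulz_small _ m); lia.
      lia.
    (* The second left-branch condition fails by classes: [rho e0] has class [c d + 1 + 1], the
       darts of the path have class [c d]. *)
    case/andP: Hj => j0 _; rewrite nth_mkseq; last by rewrite prednK.
    move/(congr1 c); rewrite /e0 class_dopp // -translate_nat !class_ccw // !class_translate //.
    by move/eqP; rewrite Z3_add2_neq.
  rewrite Ej s_lt_m nth_mkseq // -translate_nat /e0 Heps mul0n addr0 eqxx //.
by case: (eps) Ej => /= ->; lia.
Qed.

Lemma adjacent_at_transversal : exists j, adjacent_at p j e0.
Proof.
have [j jm Ej] := mem_path_vertices_ray _ _ m_gt0 opposite_foot.
exists j; rewrite /adjacent_at path_edges_base_ccw size_mkseq jm.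
by rewrite path_vertices_ray // nth_mkseq // vtx_ccw Ej eqxx.
Qed.

Lemma is_Splus_transversal s' : is_Splus p t s' <-> s' = s%:Z.
Proof.
split=> [[f [e [j [/first_adjacent_transversal -> /edgeP Ee adj ->]]]]|->].
  case: Ee adj => ->; last by rewrite dopp_f0; apply: branch_shift_transversal.
  (* The dart [f0] starts at height -1, off the path, so only [e0] can carry the branch. *)
  case/and3P => _ jm /eqP Ej; exfalso.
  have : vtx (D (- a0) (- 1)) \notin path_vertices p.
    by apply: (not_mem_path_vertices_base _ _).2; lia.
  rewrite -vtx_ccw Ej mem_nth // path_vertices_ray // size_mkseq ltnS.
  by rewrite -[m](size_mkseq (fun i => iter i adv d)).
have [j adj] := adjacent_at_transversal.
exists f0, e0, j; split=> //.
- exact/first_adjacent_transversal.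
- by rewrite -dopp_f0; apply/edgeP; right.
- by rewrite branch_shift_transversal.
Qed.

End Index.

(** * Independence of all choices, and existence of the lattice *)

Section IndexVectors.

Variables (G : graph_map) (c : dart G -> 'Z_3).
Hypothesis ccw6 : (ccw G ^+ 6 = 1)%g.
Hypothesis face3 : (face_perm G ^+ 3 = 1)%g.
Hypothesis cP : class_partition c.
Implicit Types d e f g : dart G.

Local Notation rho := (ccw G).
Local Notation adv := (straight G).

Definition has_lattice d (k m s : nat) : Prop :=
  [/\ (0 < k)%N, (s < m)%N
    & forall a b, half_turn (translate d a b) = translate d a b <-> lattice k m s a b].

Lemma index_vector_of_lattice d k m s : half_turn d = d -> has_lattice d k m s ->
  index_vector c (c d) (k%:Z, m%:Z, s%:Z).
Proof.
move=> hd [k0 sm dL].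
have hm := half_period_base ccw6 face3 k0 sm dL.
have gL := lattice_opposite k0 sm false.
set a0 := - (_ + _) in gL; set g := translate d a0 (- k%:Z).
have hg : half_turn g = g by apply/dL.
have hgm : half_period g m by apply: (half_period_translate ccw6 face3 k0 sm dL).
have hrg : half_turn (rho g) = rho g by rewrite -[half_turn _]/(rho (half_turn g)) hg.
have [l hl] := half_period_exists hrg.
exists (vtx d), (vtx g), (ray d m), (ray g m), (ray (rho g) l), k, s%:Z.
rewrite size_mkseq; split=> //.
- split; first exact: path_from_ray.
  by rewrite -(class_translate cP d a0 (- k%:Z)) //; apply: path_from_ray.
- exact: (path_edges_opposite ccw6 face3 hd k0 sm dL).
- exact: (is_dist_opposite ccw6 face3 cP hd k0 sm dL).
- split; last by apply/(is_Splus_transversal ccw6 face3 cP hd k0 sm dL hl).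
  rewrite -(class_translate cP d a0 (- k%:Z)) // -class_ccw // -(vtx_ccw g).
  exact: path_from_ray.
Qed.

Lemma half_period_unique d m1 m2 : half_period d m1 -> half_period d m2 -> m1 = m2.
Proof.
case=> m10 h1 l1 [m20 h2 l2]; case: (ltngtP m1 m2) => // lt.
  by case: (l2 m1); rewrite ?m10.
by case: (l1 m2); rewrite ?m20.
Qed.

Lemma half_turn_vtx d e : half_turn d = d -> half_turn e = e -> vtx d = vtx e ->
  c d = c e -> d = e.
Proof. by move=> hd he Ev Ec; case: (eq_vtx_class ccw6 cP Ev Ec) => [->|->]. Qed.

(** Modulo twice the lattice, the parities of x and y give four classes, one for each vertex of
    degree 3. For y even the vertex is an end of [ray d m], and the two edge sets would agree; for y
    odd the parity of x is [eps]. *)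
Lemma opposite_ends d k m s a b : half_turn d = d -> has_lattice d k m s ->
  lattice k m s a b ->
  path_edges (ray d m) != path_edges (ray (translate d a b) m) ->
  exists eps : bool,
    translate d a b = translate d (- (s%:Z + (eps * m)%N%:Z)) (- k%:Z).
Proof.
move=> hd [k0 sm dL] [x [y [-> ->]]] ne.
have parity n : exists (z : int) (r : bool), n = 2 * z + r%:Z.
  exists (n %/ 2)%Z, ((n %% 2)%Z == 1); have := divz_eq n 2.
  have := modz_ge0 n (isT : 2 != 0 :> int); have := ltz_pmod n (isT : 0 < 2 :> int).
  by case: eqP; lia.
have [x' [r Ex]] := parity x; have [y' [[] Ey]] := parity y.
  exists r; apply/(translate_eq ccw6 face3 hd k0 sm dL); exists (x' + r%:Z), (y' + 1).
  by rewrite Ex Ey; case: r {Ex}; split; lia.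
case/eqP: ne; have -> : translate d (x * m%:Z + y * s%:Z) (y * k%:Z) = translate d (r * m)%N%:Z 0.
  apply/(translate_eq ccw6 face3 hd k0 sm dL); exists x', y'.
  by rewrite Ex Ey; case: r {Ex}; split; lia.
case: r {Ex}; last by rewrite mul0n translate0.
rewrite mul1n.
(* Starting from its other end, the same path is traversed backwards. *)
have rev i : (i < m)%N -> edge (iter i adv (translate d m%:Z 0)) = edge (iter (m - i.+1) adv d).
  move=> im; rewrite -edge_dopp iter_straight_translate // dopp_translate // -translate_nat.
  congr edge; apply/(translate_eq ccw6 face3 hd k0 sm dL); exists (-1), 0; split; lia.
apply/setP => E; apply/imsetP/imsetP => -[_ /mapP [i + ->] ->]; rewrite mem_iota add0n => im.
  exists (iter (m - i.+1) adv (translate d m%:Z 0)).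
    by apply: map_f; rewrite mem_iota; lia.
  rewrite rev; last lia.
  by congr (edge (iter _ _ _)); lia.
exists (iter (m - i.+1) adv d); last exact: rev.
by apply: map_f; rewrite mem_iota; lia.
Qed.

(** All paths in an index-vector are rays and C is one of the two opposite ends, so the choices
    allowed by [index_vector] cannot affect the value. *)
Lemma index_vectorP q v : connected G -> index_vector c q v ->
  exists d, [/\ half_turn d = d, c d = q
    & forall k m s, has_lattice d k m s -> v = (k%:Z, m%:Z, s%:Z)].
Proof.
move=> conG [A [C [p [r [t [k' [s' [[Ap Cr] ne dist [Ct Spl] ->]]]]]]]].
have [d [m1 [hd cd _ hm1 Ep]]] := path_fromP ccw6 face3 cP Ap.
exists d; split=> // k m s dL; have [k0 sm dLP] := dL.
have Em : m1 = m by apply: half_period_unique hm1 (half_period_base ccw6 face3 k0 sm dLP).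
rewrite {}Em in hm1 Ep.
have [g [m2 [hg cg Cg hm2 Er]]] := path_fromP ccw6 face3 cP Cr.
have [h [l [hh ch Ch hl Et]]] := path_fromP ccw6 face3 cP Ct.
have [a [b Eab]] := connected_translate ccw6 face3 hd g conG.
have {Eab} Eg : g = translate d a b.
  have [|//|Eg] := eq_vtx_class ccw6 cP Eab; first by rewrite class_translate // cd.
  by rewrite -hg Eg half_turnK.
have Lab : lattice k m s a b by apply/dLP; rewrite -Eg.
have {}Eh : h = rho g.
  apply: half_turn_vtx; rewrite ?vtx_ccw ?Cg ?class_ccw ?ch ?cg //.
  by rewrite -[LHS]/(rho (half_turn g)) hg.
have Em2 : m2 = m.
  apply: half_period_unique hm2 _; rewrite Eg.
  exact: (half_period_translate ccw6 face3 k0 sm dLP).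
rewrite {}Em2 {}Eg in Er Eh *; rewrite Er Ep in ne dist Spl *.
have [eps Eg] := opposite_ends hd dL Lab ne.
rewrite Eg in Er Eh dist; rewrite Et Eh in Spl; rewrite Eh in hl.
rewrite size_mkseq.
have /= -> := is_dist_unique dist (is_dist_opposite ccw6 face3 cP hd k0 sm dLP eps).
by have /= -> := (is_Splus_transversal ccw6 face3 cP hd k0 sm dLP hl s').1 Spl.
Qed.

(* The Hermite normal form of the lattice of degree-3 vertices. *)
Lemma has_lattice_exists d : half_turn d = d -> exists k m s, has_lattice d k m s.
Proof.
(* Stated as membership in the stabilizer after doubling, the condition is decidable and visibly
   additive. *)
move=> hd; pose L a b := translate d (2 * a) (2 * b) == d.
have LP a b : half_turn (translate d a b) = translate d a b <-> L a b.
  rewrite half_turn_fixed //; split=> [H|/eqP H].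
    apply/eqP; rewrite -[RHS](translate0 d).
    have -> : translate d (2 * a) (2 * b) = translate (translate d a b) a b.
      by rewrite translateD //; congr translate; lia.
    by rewrite -H translateD //; congr translate; lia.
  by rewrite -[in LHS]H translateD //; congr translate; lia.
have L0 : L 0 0 by rewrite /L !mulr0 translate0.
have LD a b a' b' : L a b -> L a' b' -> L (a + a') (b + b').
  by rewrite /L !mulrDr -translateD // => /eqP ->.
have LN a b : L a b -> L (- a) (- b).
  by rewrite /L => /eqP H; rewrite -[in X in X == _]H translateD // !mulrN !subrr translate0.
have Lmul a b n : L a b -> L (n * a) (n * b).
  move=> H; have Hn (i : nat) : L (i%:Z * a) (i%:Z * b).
    by elim: i => [|i IH]; rewrite ?mul0r // -addn1 PoszD !mulrDl !mul1r; apply: LD.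
  by case: n => i //; rewrite NegzE !mulNr; apply: LN.
have exm : exists n, (0 < n)%N && L n%:Z 0.
  exists #[adv]%g; rewrite order_gt0 /L mulr0.
  have -> : 2 * #[adv]%g%:Z = (#[adv]%g * 2)%N%:Z by lia.
  by rewrite translate_nat -permX expgM expg_order expg1n perm1 eqxx.
case: (ex_minnP exm) => m /andP [m0 Lm] minm {exm}.
have reduce a b : L a b -> L (a %% m%:Z)%Z b.
  move=> H; have -> : (a %% m%:Z)%Z = a + (- (a %/ m%:Z)%Z) * m%:Z.
    by rewrite {2}(divz_eq a m%:Z); lia.
  by rewrite -[b]addr0; apply: LD => //; rewrite -(mulr0 (- (a %/ m%:Z)%Z)); apply: Lmul.
have ltm a : (`|(a %% m%:Z)%Z| < m)%N.
  by have := @modz_ge0 a m%:Z; have := @ltz_pmod a m%:Z; lia.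
(* Real parts matter only modulo [m], so the search for the least height is over a finite range. *)
have exk : exists n, (0 < n)%N && [exists i : 'I_m, L i%:Z n%:Z].
  exists #[veer G]%g; rewrite order_gt0; apply/existsP; exists (Ordinal m0) => /=.
  rewrite /L mulr0; have -> : 2 * #[veer G]%g%:Z = (#[veer G]%g * 2)%N%:Z by lia.
  by rewrite /translate /= expg0 mul1g expgM expg_order expg1n perm1 eqxx.
case: (ex_minnP exk) => k /andP [k0 /existsP [s Ls]] mink {exk}.
exists k, m, s; split=> // a b; rewrite LP; split=> [Lab|[x [y [-> ->]]]]; last first.
  by rewrite -[y * k%:Z]add0r; apply: LD; [rewrite -(mulr0 x)|]; apply: Lmul.
pose y := (b %/ k%:Z)%Z; pose r := (b %% k%:Z)%Z; pose x := ((a - y * s%:Z) %/ m%:Z)%Z.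
have Lr : L (a - y * s%:Z) r.
  have -> : r = b - y * k%:Z by rewrite {1}(divz_eq b k%:Z) -/y -/r; lia.
  by rewrite -!mulNr; apply: LD => //; apply: Lmul.
have r0 : r = 0.
  have rk := @ltz_pmod b k%:Z; have rp := @modz_ge0 b k%:Z; rewrite -/r in rk rp.
  case: (ltrgtP r 0) => // rn; first lia.
  suff : (k <= `|r|)%N by lia.
  apply: mink; apply/andP; split; first lia.
  apply/existsP; exists (Ordinal (ltm (a - y * s%:Z))) => /=.
  have -> : `|r|%N%:Z = r by lia.
  rewrite gez0_abs; first exact: reduce.
  by apply: modz_ge0; lia.
exists x, y; split; last by rewrite {1}(divz_eq b k%:Z) -/y -/r r0 addr0.
pose t := ((a - y * s%:Z) %% m%:Z)%Z.
have t0 : t = 0.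
  have tm := ltm (a - y * s%:Z); have tp : 0 <= t by apply: modz_ge0; lia.
  rewrite -/t in tm; case: (ltrgtP t 0) => // tn; first lia.
  suff : (m <= `|t|)%N by lia.
  apply: minm; rewrite gez0_abs // -r0; apply/andP; split; [lia|exact: reduce].
by have := divz_eq (a - y * s%:Z) m%:Z; rewrite -/x -/t t0; lia.
Qed.

End IndexVectors.

(** * Necessity *)

(** Both generators are multiplied by w. From m w one gets m = k n and s = k x with x = - a; from w
    (s + k w) = - k + (s + k) w one gets x^2 + x + 1 = - u n. *)
Lemma lattice_rotation (k m s : nat) : (0 < k)%N -> (s < m)%N ->
  (forall a b, lattice k m s a b <-> lattice k m s (- b) (a + b)) ->
  exists n x : int, [/\ 0 <= x, x < n, m%:Z = k%:Z * n, s%:Z = k%:Z * x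
                     & (n %| x ^+ 2 + x + 1)%Z].
Proof.
move=> k0 sm rot.
have /rot [a [n]] : lattice k m s m%:Z 0 by exists 1, 0; split; lia.
rewrite oppr0 addr0 => -[E0 Em].
have /rot [u [v [Eu Ev]]] : lattice k m s s%:Z k%:Z by exists 0, 1; split; lia.
have k0' : k%:Z != 0 by lia.
have n0 : 0 < n by rewrite -(@pmulr_lgt0 _ k%:Z) -?Em; lia.
have Es : s%:Z = k%:Z * - a.
  by apply: (mulfI (lt0r_neq0 n0)); rewrite mulrA -Em; lia.
have Ev' : v = - a + 1 by apply: (mulIf k0'); rewrite -Ev Es; lia.
have Eu' : (- a) ^+ 2 + - a + 1 = - u * n.
  apply: (mulIf k0'); move: Eu; rewrite Ev' Em Es => Eu; lia.
exists n, (- a); split.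
- by rewrite -(@pmulr_rge0 _ k%:Z) -?Es; lia.
- by rewrite -(@ltr_pM2l _ k%:Z) -?Es ?[k%:Z * n]mulrC -?Em; lia.
- by rewrite mulrC.
- by [].
- by apply/dvdzP; exists (- u).
Qed.

Section Necessity.

Variables (G : graph_map) (c : dart G -> 'Z_3).
Hypotheses (GP : family_P G) (cP : class_partition c).

Lemma family_P_ccw6 : (ccw G ^+ 6 = 1)%g.
Proof.
case: GP => _ _ deg; apply/permP => d; rewrite perm1 permX.
have [/eqP c3|/eqP c6] := orP (deg (vtx d) (imset_f _ (isT : d \in dart G))).
  by rewrite -[6%N]/(3 + 3)%N iterD -c3 !iter_porbit.
by rewrite -c6 iter_porbit.
Qed.

Lemma family_P_face3 : (face_perm G ^+ 3 = 1)%g.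
Proof.
case: GP => -[_ _ tri] _ _; apply/permP => d; rewrite perm1 permX.
by case/andP: (tri d) => /eqP <- _; rewrite iter_porbit.
Qed.

Lemma one_point_orbit (k m s : int) :
  (forall v : int * int * int, index_orbit c v <-> v = (k, m, s)) ->
  exists n x : int, [/\ 0 <= x, x < n, m = k * n, s = k * x
                     & (n %| x ^+ 2 + x + 1)%Z].
Proof.
move=> orb; have ccw6 := family_P_ccw6; have face3 := family_P_face3.
have [q [A [C [p [r [t [k0 [s0 [[Ap _] _ _ _ _]]]]]]]]] := (orb (k, m, s)).2 erefl.
have [d [_ [hd _ _ _ _]]] := path_fromP ccw6 face3 cP Ap.
have hd' : half_turn (ccw G d) = ccw G d by rewrite -[LHS]/(ccw G (half_turn d)) hd.
have [k1 [m1 [s1 L1]]] := has_lattice_exists ccw6 face3 hd.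
have [k2 [m2 [s2 L2]]] := has_lattice_exists ccw6 face3 hd'.
have Orb (e : dart G) k3 m3 s3 : half_turn e = e ->
    has_lattice e k3 m3 s3 -> (k3%:Z, m3%:Z, s3%:Z) = (k, m, s).
  by move=> he L3; apply/orb; exists (c e); apply: index_vector_of_lattice.
have := Orb _ _ _ _ hd' L2; case: (Orb _ _ _ _ hd L1) => <- <- <- [Ek Em Es].
rewrite Ek Em Es in L2; have [k_gt0 s_lt_m LP] := L1; have [_ _ LP'] := L2.
(* The lattices at [d] and at [ccw d] have the same normal form, hence are equal; by [translate_ccw]
   this is invariance under w. *)
apply: lattice_rotation => // a b; rewrite -LP' -LP translate_ccw //.
by split=> [/perm_inj //|]; rewrite -ccw_half_turn => ->.
Qed.

End Necessity.

(** * Triangulations: connectivity and Euler's formula *)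

Section Triangulations.

Variable G : graph_map.
Hypothesis face3 : (face_perm G ^+ 3 = 1)%g.
Hypothesis noloop : loopless G.
Implicit Types d e : dart G.

Local Notation rho := (ccw G).
Local Notation tau := (dopp G).
Local Notation phi := (face_perm G).

Lemma face_permE d : phi d = (rho^-1)%g (tau d).
Proof. by rewrite permM. Qed.

Lemma vtx_face d : vtx (phi d) = vtx (tau d).
Proof. by rewrite -[in RHS](permKV rho (tau d)) -face_permE vtx_ccw. Qed.

Lemma face_perm3 d : phi (phi (phi d)) = d.
Proof. by move/permP/(_ d): face3; rewrite permX perm1. Qed.

(** Face orbits close up after three steps, and any two of three cyclically ordered vertices are
    consecutive, hence distinct without loops. *)
Lemma face_triangle_loopless d : face_triangle d.
Proof.
have N e : vtx (phi e) != vtx e by rewrite vtx_face.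
have N2 : vtx (phi (phi d)) != vtx d by rewrite -{2}(face_perm3 d) eq_sym.
have N1 := N (phi d).
have Nd e e' : vtx e != vtx e' -> e != e' by apply: contra_neq => ->.
apply/andP; split; last first.
  by rewrite /= !inE !negb_or andbT -andbA; apply/and3P; split; rewrite eq_sym.
have u3 : uniq [:: d; phi d; phi (phi d)].
  by rewrite /= !inE !negb_or andbT -andbA; apply/and3P; split; rewrite eq_sym Nd.
rewrite -[3%N]/(size [:: d; phi d; phi (phi d)]) -(card_uniqP u3); apply/eqP.
apply: eq_card => e; rewrite !inE; apply/idP/idP => [/porbitP [i ->]|].
  elim: i => [|i IH]; first by rewrite expg0 perm1 eqxx.
  rewrite expgSr permM; case/or3P: IH => /eqP ->; rewrite ?face_perm3 eqxx ?orbT //.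
by case/or3P => /eqP ->; rewrite ?porbit_id // -?[phi (phi d)]permM;
  [apply: (mem_porbit phi 1)|apply: (mem_porbit phi 2)].
Qed.

Lemma adjv_dopp e : adjv (vtx e) (vtx (tau e)).
Proof. by apply/existsP; exists e; rewrite !eqxx. Qed.

(* A walk through A is rerouted along the link of A. *)
Lemma connected_delete_vertex A : connected G -> A \in vertices G ->
  connected_on (vertices G :\ A).
Proof.
move=> conG AV B C; rewrite !inE => /andP [BA BV] /andP [CA CV].
set V := vertices G :\ A; set R := fun u v => _.
have vV e : (vtx e \in V) = (vtx e != A) by rewrite !inE (imset_f (porbit rho)) ?andbT.
(* Consecutive neighbours of A are joined by the third side of a triangle at A. *)
have link1 e : vtx e = A -> connect R (vtx (tau e)) (vtx (tau (rho e))).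
  move=> eA; apply: connect1.
  have Eg : tau (phi (phi e)) = rho e.
    by rewrite -{2}(face_perm3 e) [phi (phi (phi e))]face_permE permKV.
  have Ev : vtx (tau (rho e)) = vtx (tau (phi e)) by rewrite -Eg doppK vtx_face.
  rewrite /R !vV -[X in [&& _ != X, _ & _]]eA noloop -eA -[X in _ != X]vtx_ccw noloop /=.
  by rewrite Ev -vtx_face adjv_dopp.
have link e e' : vtx e = A -> e' \in vtx e -> connect R (vtx (tau e)) (vtx (tau e')).
  move=> eA /porbitP [i ->]; elim: i => [|i IH]; first by rewrite expg0 perm1 connect0.
  apply: connect_trans IH _; rewrite expgSr permM; apply: link1.
  by rewrite -eA; apply/eqP; rewrite eq_vtx; apply: mem_porbit.
have /connectP [w] := conG B C BV CV.
(* Induction over the walk needs both cases: off A, its end is reached; at A, all neighbours of A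
   are reached. *)
have {conG} main : path (@adjv G) B w ->
  (last B w != A -> connect R B (last B w)) /\
  (forall e, vtx e = A -> last B w = A -> connect R B (vtx (tau e))).
  elim/last_ind: w => [|w X IH].
    by split=> [_|e _ /= E]; [exact: connect0 | rewrite E eqxx in BA].
  rewrite rcons_path last_rcons => /andP [/IH [IH1 IH2]].
  case/existsP => f /andP [/eqP fY /eqP fX].
  have [YA|YA] := eqVneq (last B w) A.
    rewrite -fX; split=> [_|e eA E]; first by apply: IH2; rewrite ?fY.
    by case/eqP: (noloop f); rewrite E fY YA.
  split=> [XA|e eA XA].
    apply: connect_trans (IH1 YA) (connect1 _).
    by rewrite /R -fX -fY !vV fX fY YA XA -fX -fY adjv_dopp.
  apply: connect_trans (IH1 YA) _.
  by rewrite -fY -[f]doppK; apply: link; rewrite fX XA // -eA mem_vtx.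
move=> Bw Ew; rewrite Ew in CA *.
suff /main [H _] : path (@adjv G) B w by apply: H.
by apply: sub_path Bw => u v /and3P [].
Qed.

Lemma sum_porbits (s : {perm dart G}) (F : dart G -> nat) n :
  (forall e, \sum_(d in porbit s e) F d = n)%N ->
  (\sum_d F d = #|porbits s| * n)%N.
Proof.
move=> H; rewrite (partition_big (porbit s) (mem (porbits s))) /=; last first.
  by move=> d _; exact: imset_f.
rewrite -sum_nat_const; apply: eq_bigr => _ /imsetP [e _ ->]; rewrite -(H e).
by apply: eq_bigl => d; rewrite eq_porbit_mem.
Qed.

Lemma card_edges : #|{: dart G}| = (#|edges G| * 2)%N.
Proof.
transitivity (\sum_(d : dart G) 1)%N; first by rewrite sum1_card.
apply: sum_porbits => e; rewrite sum1_card.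
have -> : porbit tau e = [set e; tau e].
  by apply/setP => f; rewrite !inE; apply/edgeP/orP => -[/eqP ->|/eqP ->]; [left|right|left|right].
by rewrite cards2 eq_sym dopp_neq.
Qed.

Lemma card_faces : #|{: dart G}| = (#|faces G| * 3)%N.
Proof.
transitivity (\sum_(d : dart G) 1)%N; first by rewrite sum1_card.
apply: sum_porbits => e; rewrite sum1_card.
by have /andP [/eqP] := face_triangle_loopless e.
Qed.

Variable c : dart G -> 'Z_3.
Hypothesis ccw6 : (rho ^+ 6 = 1)%g.
Hypothesis cP : class_partition c.

(* A vertex of degree 3 or 6 gets weight 6 when the darts fixed by the half-turn
   are counted twice. *)
Lemma card_vertices :
  (#|{: dart G}| + #|[set d : dart G | half_turn d == d]| = #|vertices G| * 6)%N.
Proof.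
transitivity (\sum_(d : dart G) (1 + (half_turn d == d)))%N.
  by rewrite big_split /= sum1_card -sum1dep_card [in LHS]big_mkcond /=; congr (_ + _)%N;
     apply: eq_bigr => d _; case: ifP.
apply: sum_porbits => e.
have fixed d : d \in porbit rho e -> (half_turn d == d) = (half_turn e == e).
  case/porbitP => i ->; elim: i => [|i IH]; first by rewrite expg0 perm1.
  by rewrite expgSr permM -ccw_half_turn (inj_eq perm_inj).
rewrite (eq_bigr (fun _ => 1 + (half_turn e == e)))%N; last first.
  by move=> d /fixed ->.
by rewrite sum_nat_const (card_vtx ccw6 cP); case: ifP.
Qed.

(** The fixed darts belong to four vertices of degree 3. With N darts there are N/6 + 2 vertices,
    N/3 faces and N/2 edges. *)
Lemma euler_four_fixed : #|[set d : dart G | half_turn d == d]| = 12%N ->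
  (#|vertices G| + #|faces G| = #|edges G| + 2)%N.
Proof. have := card_vertices; have := card_edges; have := card_faces; lia. Qed.

End Triangulations.

(** * The quotient by an ideal *)

(** Multiplication by [h] kills [w + w] but not 1. *)
Lemma Zp_double_neq1 h (w : 'Z_(h.*2)) : (0 < h)%N -> w + w <> 1.
Proof.
move=> h0 /(congr1 (fun z => z *+ h)); rewrite -mulr2n -mulrnA mul2n.
have H : (1 < h.*2)%N by rewrite -addnn; lia.
rewrite -mulr_natr pchar_Zp // mulr0 => /(congr1 val) /= /esym.
by rewrite val_Zp_nat // modn_small; lia.
Qed.

Lemma Zp_intr_eq0 N (a : int) : (1 < N)%N -> ((a%:~R : 'Z_N) == 0) = (N%:Z %| a)%Z.
Proof.
move=> N1; have Hn (i : nat) : ((i%:R : 'Z_N) == 0) = (N %| i)%N.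
  by rewrite -(inj_eq val_inj) /= val_Zp_nat.
case: a => i; first exact: Hn.
by rewrite NegzE mulrNz oppr_eq0 dvdzE abszN; apply: Hn.
Qed.

Lemma Zp_double_intr h (a : int) : (0 < h)%N ->
  ((a%:~R : 'Z_(h.*2)) + a%:~R == 0) = (h%:Z %| a)%Z.
Proof.
move=> h0; rewrite -mulrzDr Zp_intr_eq0; last by lia.
rewrite -!mul2n -[a + a]mul2z PoszM dvdz_mul2l //.
Qed.

Lemma card_Zp_opp_fixed h : (0 < h)%N -> #|[set w : 'Z_(h.*2) | - w == w]| = 2%N.
Proof.
move=> h0; have h1 : (1 < h.*2)%N by lia.
have vh : (h%:R : 'Z_(h.*2)) = h :> nat by rewrite val_Zp_nat // modn_small; lia.
have h_neq0 : (0 : 'Z_(h.*2)) != h%:R by apply/eqP => /(congr1 val); rewrite /= vh; lia.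
suff -> : [set w : 'Z_(h.*2) | - w == w] = [set 0; h%:R] by rewrite cards2 h_neq0.
apply/setP => w; rewrite !inE -subr_eq0 -opprD oppr_eq0.
have Ew : w = (w%:Z)%:~R by rewrite -[LHS]natr_Zp.
have wlt : (w < h.*2)%N by rewrite -[X in (_ < X)%N](Zp_cast h1) ltn_ord.
rewrite {1 2}Ew Zp_double_intr // dvdzE /=; apply/dvdnP/orP => [[q Eq]|[/eqP ->|/eqP ->]].
- have [q0|q1] : q = 0%N \/ q = 1%N by nia.
    by left; apply/eqP/val_inj; rewrite /= Eq q0.
  by right; apply/eqP/val_inj; rewrite /= vh Eq q1 mul1n.
- by exists 0%N.
- by exists 1%N; rewrite vh mul1n.
Qed.

Lemma pair_mulrn (V W : zmodType) (u : V) (w : W) (i : nat) :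
  (u, w) *+ i = (u *+ i, w *+ i).
Proof. by elim: i => // i IH; rewrite !mulrS IH. Qed.

Lemma pair_mulrz (V W : zmodType) (u : V) (w : W) (a : int) :
  (u, w) *~ a = (u *~ a, w *~ a).
Proof. by case: a => i; rewrite ?NegzE ?mulrNz -?pmulrn pair_mulrn. Qed.

(** * The triangulation attached to an ideal *)

Section Sufficiency.

Variables k n x : nat.
Hypotheses (k_gt0 : (0 < k)%N) (x_lt_n : (x < n)%N).

Local Notation Q := ('Z_((k * n).*2) * 'Z_(k.*2))%type.
Local Notation dartT := (Q * 'Z_3)%type.

(* [Q] is the quotient of Z[w], w a primitive sixth root of unity, by twice the
   lattice spanned by [k n] and [k (w + x)]: the class of [a + b (w + x)] is
   [(a, b)].  The dart [(z, i)] leaves the vertex [z] (identified with [- z]) in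
   the direction [w ^ i]. *)
Definition direction (i : 'Z_3) : Q :=
  match val i with
  | 0 => (1, 0)
  | 1 => (- x%:R, 1)
  | _ => (- x%:R - 1, 1)
  end.

(** After w^2 comes w^3 = - 1; the half-turn identifies direction - 1 at z with direction 1 at -
    z. *)
Definition pillow_ccw_fun (d : dartT) : dartT :=
  (if d.2 == 2 then - d.1 else d.1, d.2 + 1).

(** The reverse dart leaves z + w^i in direction - w^i, which is direction w^i at - (z + w^i). *)
Definition pillow_dopp_fun (d : dartT) : dartT := (- d.1 - direction d.2, d.2).

Lemma pillow_ccw_inj : injective pillow_ccw_fun.
Proof.
case=> z i [z' j]; rewrite /pillow_ccw_fun => E.
have Ei : i = j by apply: (addIr 1); apply: (congr1 (fun d : dartT => d.2) E).
move: (congr1 (fun d : dartT => d.1) E); rewrite /= Ei.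
by case: ifP => _ => [/oppr_inj|] ->.
Qed.

Lemma pillow_doppK : involutive pillow_dopp_fun.
Proof. by case=> z i; rewrite /pillow_dopp_fun /= opprD !opprK addrK. Qed.

(** Every direction has a coordinate 1, which is not a double modulo an even number. This excludes
    loops and edges equal to their own reverse. *)
Lemma direction_neq_double i (z : Q) : z + z <> direction i.
Proof.
have n0 : (0 < k * n)%N by rewrite muln_gt0 k_gt0; lia.
move=> E; have E1 := congr1 (fun d : Q => d.1) E; have E2 := congr1 (fun d : Q => d.2) E.
case: i {E} E1 E2 => [[|[|[|//]]] ?] E1 E2.
- exact: Zp_double_neq1 n0 E1.
- exact: Zp_double_neq1 k_gt0 E2.
- exact: Zp_double_neq1 k_gt0 E2.
Qed.

Definition pillow_ccw := perm pillow_ccw_inj.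
Definition pillow_dopp := perm (inv_inj pillow_doppK).

Lemma pillow_dopp_inv : involutive pillow_dopp.
Proof. by move=> d; rewrite !permE pillow_doppK. Qed.

Lemma pillow_dopp_neq d : pillow_dopp d != d.
Proof.
apply/eqP; rewrite permE; case: d => z i [] E.
by apply: (@direction_neq_double i (- z)); rewrite -{1}E opprD !opprK addrAC addrN add0r.
Qed.

Definition pillow : graph_map := GraphMap pillow_ccw pillow_dopp_inv pillow_dopp_neq.

Lemma pillow_ccwE z i : ccw pillow (z, i) = (if i == 2 then - z else z, i + 1) :> dartT.
Proof. exact: permE. Qed.

Lemma pillow_doppE z i : dopp pillow (z, i) = (- z - direction i, i) :> dartT.
Proof. exact: permE. Qed.

Lemma Z3P (i : 'Z_3) : [\/ i = 0, i = 1 | i = 2].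
Proof.
by case: i => [[|[|[|//]]] ?]; [constructor 1|constructor 2|constructor 3]; apply: val_inj.
Qed.

Lemma pillow_half_turn (z : Q) (i : 'Z_3) : half_turn ((z, i) : dart pillow) = (- z, i) :> dartT.
Proof.
rewrite /half_turn !pillow_ccwE; have [] := Z3P i => ->; congr pair; exact: val_inj.
Qed.

Lemma pillow_ccw6 : (ccw pillow ^+ 6 = 1)%g.
Proof.
apply/permP => -[z i]; rewrite permX perm1 -[LHS]/(half_turn (half_turn (_ : dart pillow))).
by rewrite !pillow_half_turn opprK.
Qed.

Lemma direction1 : direction 1 = direction 0 + direction 2.
Proof. by congr pair; rewrite /= ?add0r // addrC subrK. Qed.

Lemma pillow_face3 : (face_perm pillow ^+ 3 = 1)%g.
Proof.
(* This product is the inverse of [face_perm] and needs no inverse of [ccw]; the triangle closes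
   because w = 1 + w^2. *)
have E : ((ccw pillow * dopp pillow) ^+ 3 = 1)%g.
  apply/permP => -[z i]; rewrite permX perm1 /= !permM.
  rewrite !(pillow_ccwE, pillow_doppE).
  have e11 : 1 + 1 = 2 :> 'Z_3 by apply: val_inj.
  have e21 : 2 + 1 = 0 :> 'Z_3 by apply: val_inj.
  have [] := Z3P i => ->; rewrite /= !(add0r, e11, e21) direction1;
    by congr pair; rewrite !opprD !opprK !addrA ?subrK ?addrK ?subrK ?addrK.
have <- : ((ccw pillow * dopp pillow)^-1 = face_perm pillow)%g.
  rewrite invMg; congr (_ * _)%g; apply: (mulgI (dopp pillow)).
  by rewrite mulgV; apply/permP => d; rewrite permM doppK perm1.
by rewrite expVgn E invg1.
Qed.

Definition pillow_class (d : dart pillow) : 'Z_3 := (d : dartT).2.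

Lemma pillow_classP : class_partition pillow_class.
Proof. by case=> z i; rewrite /pillow_class pillow_ccwE pillow_doppE. Qed.

Lemma pillow_loopless : loopless pillow.
Proof.
case=> z i; apply/eqP => /(eq_vtx_class pillow_ccw6 pillow_classP) [].
- by rewrite class_dopp //; apply: pillow_classP.
- by apply/eqP; apply: pillow_dopp_neq.
rewrite pillow_doppE pillow_half_turn => /(congr1 (fun d : dartT => d.1)) /= /eqP.
rewrite -subr_eq0 opprK addrAC addNr add0r oppr_eq0 => /eqP di.
by apply: (@direction_neq_double i 0); rewrite addr0 di.
Qed.

Lemma pillow_translate0 (z : Q) (a b : int) :
  translate ((z, 0) : dart pillow) a b = (z + direction 0 *~ a + direction 1 *~ b, 0) :> dartT.
Proof.
have power (f : {perm dart pillow}) (u : Q) :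
    (forall z, f (z, 0) = (z + u, 0) :> dartT) ->
    forall a z, expgz f a (z, 0) = (z + u *~ a, 0) :> dartT.
  move=> fE.
  have fn m y : (f ^+ m)%g (y, 0) = (y + u *+ m, 0) :> dartT.
    elim: m y => [|m IH] y; first by rewrite expg0 perm1 addr0.
    by rewrite expgS permM fE IH mulrS addrA.
  case=> m y; first exact: fn.
  rewrite /=; apply: (@perm_inj _ (f ^+ m.+1)%g); rewrite permKV.
  by rewrite fn NegzE mulrNz subrK.
rewrite /translate permM (power _ (direction 0)) => [|y]; last first.
  rewrite -translate10 -[LHS]half_turnK ?pillow_ccw6 // -dopp_half_turn ?pillow_ccw6 //.
  by rewrite pillow_doppE pillow_half_turn opprD !opprK.
rewrite (power _ (direction 1)) // => y.
rewrite /veer permM permX permM /= !(pillow_ccwE, pillow_doppE) add0r /=.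
congr pair; last exact: val_inj.
by rewrite opprD !opprK.
Qed.

(** In the basis 1, w + x the vector a + b w has coordinates a - x b and b, and the lattice is a
    product. *)
Lemma lattice_pillow (a b : int) : lattice k (k * n) (k * x) a b <->
  (k%:Z %| b)%Z /\ ((k * n)%N%:Z %| a - x%:Z * b)%Z.
Proof.
rewrite !PoszM; split=> [[p [q [-> ->]]]|[/dvdzP [q ->] /dvdzP [p Ea]]].
  split; first by rewrite dvdz_mull.
  by apply/dvdzP; exists p; lia.
by exists p, q; split=> //; lia.
Qed.

(** Since 2 z = 0, the point z + u is its own negative iff 2 u = 0 in [Q]; the moduli of [Q] being
    doubled, this says that u lies in the lattice. *)
Lemma has_lattice_pillow0 (z : Q) : - z = z ->
  has_lattice ((z, 0) : dart pillow) k (k * n) (k * x).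
Proof.
move=> zN; split=> //; first by rewrite ltn_mul2l k_gt0.
move=> a b; rewrite lattice_pillow pillow_translate0 pillow_half_turn.
have kn0 : (0 < k * n)%N by rewrite muln_gt0 k_gt0; lia.
set v := z + _ + _.
have Ev : v = (z.1 + (a - x%:Z * b)%:~R, z.2 + b%:~R).
  rewrite /v; case: (z) => z1 z2 /=.
  rewrite !pair_mulrz mul0rz; congr pair => /=; rewrite ?addr0 //.
  rewrite mulNrz rmorphB rmorphM /= -addrA; congr (_ + (_ - _)).
  by rewrite -mulrzr.
have opp_fixed (V : zmodType) (u w : V) : - u = u -> (- (u + w) = u + w) <-> (w + w = 0).
  move=> uN; split=> [/eqP|/eqP]; last first.
    by rewrite addr_eq0 => /eqP ww; rewrite opprD uN -ww.
  by rewrite opprD uN => /eqP/addrI ww; rewrite -{1}ww addNr.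
have z1N : - z.1 = z.1 by rewrite -{2}zN.
have z2N : - z.2 = z.2 by rewrite -{2}zN.
have fixedE : (- v, 0) = (v, 0) :> dartT <-> - v.1 = v.1 /\ - v.2 = v.2.
  split=> [E|[E1 E2]].
    have {}E : - v = v := congr1 (fun d : dartT => d.1) E.
    by split; [rewrite -{2}E | rewrite -{2}E].
  congr pair; case: (v) E1 E2 => v1 v2 /= E1 E2; exact: (congr2 pair E1 E2).
apply: (iff_trans fixedE).
rewrite Ev /= !opp_fixed //; split=> [[/eqP H1 /eqP H2]|[H1 H2]].
  by rewrite !Zp_double_intr // in H1 H2.
by split; apply/eqP; rewrite Zp_double_intr.
Qed.

(** Two solutions of 2 w = 0 in each factor of [Q], times three directions. *)
Lemma card_pillow_fixed : #|[set d : dart pillow | half_turn d == d]| = 12%N.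
Proof.
have kn0 : (0 < k * n)%N by rewrite muln_gt0 k_gt0; lia.
have -> : [set d : dart pillow | half_turn d == d]
  = setX (setX [set w : 'Z_((k * n).*2) | - w == w] [set w : 'Z_(k.*2) | - w == w]) [set: 'Z_3].
  apply/setP => -[[z1 z2] i]; rewrite !inE pillow_half_turn andbT.
  by rewrite -pair_eqE /= /pair_eq /= eqxx andbT.
by rewrite !cardsX !card_Zp_opp_fixed // cardsT card_ord.
Qed.

Lemma pillow_connected : connected pillow.
Proof.
have sym : connect_sym (@adjv pillow).
  apply: sym_connect_sym => A B.
  by apply/existsP/existsP => -[d /andP [dA dB]]; exists (dopp pillow d); rewrite doppK dA dB.
pose V z := vtx ((z, 0) : dart pillow).
have Vi z i : vtx ((z, i) : dart pillow) = V z.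
  have V1 y : vtx ((y, 1) : dart pillow) = V y.
    by rewrite /V -(vtx_ccw ((y, 0) : dart pillow)) pillow_ccwE /= add0r.
  have e11 : 1 + 1 = 2 :> 'Z_3 by apply: val_inj.
  have [] := Z3P i => -> //; rewrite -V1 -(vtx_ccw ((z, 1) : dart pillow)) pillow_ccwE /=.
  by rewrite e11.
have VN z : V (- z) = V z.
  by rewrite /V -(vtx_half_turn ((z, 0) : dart pillow)) pillow_half_turn.
have step z i m : connect (@adjv pillow) (V z) (V (z + direction i *+ m)).
  elim: m => [|m IH]; first by rewrite addr0 connect0.
  apply: connect_trans IH (connect1 _); set y := z + _.
  apply/existsP; exists ((y, i) : dart pillow); rewrite Vi pillow_doppE Vi eqxx /=.
  by rewrite -VN opprD !opprK /y mulrSr addrA.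
have from0 z : connect (@adjv pillow) (V 0) (V z).
  apply: connect_trans (step 0 1 (val z.2)) _.
  (* The steps along w have set the second coordinate and shifted the first by - x each; steps along
     1 make up for it. *)
  pose a := z.1 + x%:R *+ val z.2.
  have E : z = 0 + direction 1 *+ val z.2 + direction 0 *+ val a.
    have Ea : (val a)%:R = a := natr_Zp a.
    have Ez : (val z.2)%:R = z.2 := natr_Zp z.2.
    rewrite add0r !pair_mulrn mul0rn Ez Ea [LHS]surjective_pairing.
    by congr pair; rewrite /= ?addr0 // /a mulNrn addrC addrK.
  by rewrite [X in connect _ _ (V X)]E; apply: step.
move=> _ _ /imsetP [[z i] _ ->] /imsetP [[z' i'] _ ->].
rewrite (eq_connect (e' := @adjv pillow)) => [|A B]; last first.
  apply/and3P/idP => [[] //|AB]; split=> //; case/existsP: AB => d /andP [/eqP EA /eqP EB].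
    by rewrite -EA; apply: imset_f.
  by rewrite -EB; apply: imset_f.
rewrite -![porbit _ _]/(vtx _) !Vi.
by apply: connect_trans (from0 z'); rewrite sym.
Qed.

Lemma pillow_family_P : family_P pillow.
Proof.
have tri := face_triangle_loopless pillow_face3 pillow_loopless.
have euler := euler_four_fixed pillow_face3 pillow_loopless
  pillow_ccw6 pillow_classP card_pillow_fixed.
split; [split|split|].
- exact: pillow_loopless.
- by split; first exact: pillow_connected.
- exact: tri.
(* Six times the number of vertices exceeds 12. *)
- have := card_vertices pillow_ccw6 pillow_classP; rewrite card_pillow_fixed.
  have : (0 < #|{: dart pillow}|)%N by apply/card_gt0P; exists ((0, 0) : dart pillow).
  lia.
- exact: pillow_connected.
- by move=> A; apply: connected_delete_vertex pillow_face3 pillow_loopless _ pillow_connected.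
- by move=> _ /imsetP [d _ ->]; rewrite (card_vtx pillow_ccw6 pillow_classP); case: ifP.
Qed.

Hypothesis dvd_n : (n%:Z %| x%:Z ^+ 2 + x%:Z + 1)%Z.

Lemma lattice_pillow_rotation a b :
  lattice k (k * n) (k * x) a b <-> lattice k (k * n) (k * x) (- b) (a + b).
Proof.
have rot a' b' : lattice k (k * n) (k * x) a' b' -> lattice k (k * n) (k * x) (- b') (a' + b').
  case/dvdzP: dvd_n => e Ee [p [q]]; rewrite !PoszM => -[-> ->].
  (* The coordinates of w (p n + q (x + w)) over n and x + w, from x^2 + x + 1 = e n. *)
  exists (- q * e - p * x%:Z), (p * n%:Z + q * x%:Z + q); split; last by lia.
  have Ee' : x%:Z * x%:Z + x%:Z = e * n%:Z - 1 by rewrite -Ee expr2; lia.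
  transitivity (- (q * k%:Z) * (e * n%:Z - (x%:Z * x%:Z + x%:Z))); last by lia.
  by rewrite Ee'; lia.
split; first exact: rot.
(* Two further multiplications by w amount to w^3 = - 1 in total. *)
move=> /rot/rot [p [q [Ea Eb]]]; exists (- p), (- q); lia.
Qed.

(** Direction 0 is [has_lattice_pillow0]; turning to the next direction replaces the lattice by its
    product with w^-1, which is the same ideal. *)
Lemma has_lattice_pillow (d : dart pillow) : half_turn d = d ->
  has_lattice d k (k * n) (k * x).
Proof.
have next e : has_lattice e k (k * n) (k * x) -> has_lattice (ccw pillow e) k (k * n) (k * x).
  case=> k0 lt eL; split=> // a b; rewrite (translate_ccw pillow_ccw6 pillow_face3).
  rewrite lattice_pillow_rotation -eL -ccw_half_turn.
  by split=> [/perm_inj|->].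
case: d => z i; rewrite pillow_half_turn => /(congr1 (fun d : dartT => d.1)) /= zN.
have Lz := has_lattice_pillow0 zN; have Lz1 := next _ Lz; have Lz2 := next _ Lz1.
have e11 : 1 + 1 = 2 :> 'Z_3 by apply: val_inj.
by have [] := Z3P i => ->; rewrite ?pillow_ccwE ?add0r ?e11 in Lz1 Lz2.
Qed.

Lemma pillow_orbit v :
  index_orbit pillow_class v <-> v = (k%:Z, (k * n)%N%:Z, (k * x)%N%:Z).
Proof.
split=> [[q]|->].
  case/(index_vectorP pillow_ccw6 pillow_face3 pillow_classP pillow_connected) => d [hd _ dL].
  exact: dL (has_lattice_pillow hd).
pose d0 : dart pillow := (0, 0); have hd : half_turn d0 = d0 by rewrite pillow_half_turn oppr0.
exists (pillow_class d0).
exact: (index_vector_of_lattice pillow_ccw6 pillow_face3 pillow_classP hd (has_lattice_pillow hd)).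
Qed.

End Sufficiency.

Theorem theorem4p1 (k m s : int) (hk : 1 <= k) (hm : 1 <= m)
    (hs0 : 0 <= s) (hsm : s < m) :
  (exists (P : graph_map) (c : dart P -> 'Z_3),
     [/\ family_P P, class_partition c &
         forall v : int * int * int, index_orbit c v <-> v = (k, m, s)])
  <->
  (exists n x : int,
     [/\ 0 <= x, x < n, m = k * n, s = k * x
       & (n %| x ^+ 2 + x + 1)%Z]).
Proof.
split=> [[P [c [PP cP orb]]]|[n [x [x0 xn Em Es dvd]]]].
  exact: (one_point_orbit PP cP orb).
have [k' Ek] : exists k' : nat, k = k'%:Z by exists `|k|%N; lia.
have [n' En] : exists n' : nat, n = n'%:Z by exists `|n|%N; lia.
have [x' Ex] : exists x' : nat, x = x'%:Z by exists `|x|%N; lia.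
subst k n x; have k0 : (0 < k')%N by [].
have lt : (x' < n')%N by [].
exists (pillow k0 lt), (@pillow_class k' n' x' k0 lt); split.
- exact: pillow_family_P.
- exact: pillow_classP.
- by move=> v; rewrite Em Es -!PoszM; apply: pillow_orbit.
Qed.
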